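(* Let $d,m,k$ be integers with $1\le k\le d$, $m\le d-2$, and either $m\ge0.62d$, or $m\ge0.6(d-1)$ and $d\le15$. Let $P$ be a $d$-dimensional polytope with $d+k$ vertices. If $P$ is a triplex, then $f_m(P)=\phi_m(d+k,d)$. If $P$ is not a triplex, then $f_m(P)>\phi_m(d+k,d)$.
   Context: $f_m(P)$ is the number of $m$-dimensional faces of $P$, and $\phi_m(v,d)=\binom{d+1}{m+1}+\binom{d}{m+1}-\binom{2d+1-v}{m+1}$. A $d$-polytope with $d+k$ vertices is a triplex if it is combinatorially equivalent to $M_{k,d-k}$, a $(d-k)$-fold pyramid over a $k$-dimensional simplicial prism (combinatorially the product of a $(k-1)$-simplex and a segment). *)

(* Defs.v *)
From mathcomp Require Import all_boot all_order all_algebra finmap.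
From mathcomp Require Import boolp classical_sets functions cardinality reals.

Set Implicit Arguments.
Unset Strict Implicit.
Unset Printing Implicit Defensive.

Import Order.TTheory GRing.Theory Num.Theory.

Local Open Scope classical_set_scope.
Local Open Scope ring_scope.

Definition conv_hull (R : realType) (n : nat) (A : set 'rV[R]_n) :
    set 'rV[R]_n :=
  [set x | exists (r : nat) (p : 'I_r -> 'rV[R]_n) (w : 'I_r -> R),
    [/\ forall i, A (p i), forall i, 0 <= w i, \sum_i w i = 1
      & x = \sum_i w i *: p i]].

Definition aff_hull (R : realType) (n : nat) (A : set 'rV[R]_n) :
    set 'rV[R]_n :=
  [set x | exists (r : nat) (p : 'I_r -> 'rV[R]_n) (w : 'I_r -> R),
    [/\ forall i, A (p i), \sum_i w i = 1 & x = \sum_i w i *: p i]].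

Definition is_polytope (R : realType) (n : nat) (P : set 'rV[R]_n) : Prop :=
  exists s : seq 'rV[R]_n, P = conv_hull [set` s].

(* The empty set has dimension -1 and so satisfies has_dim for no k. *)
Definition has_dim (R : realType) (n : nat) (A : set 'rV[R]_n) (k : nat) :
    Prop :=
  exists (x0 : 'rV[R]_n) (W : {vspace 'rV[R]_n}),
    aff_hull A = [set x0 + w | w in [set` W]] /\ \dim W = k.

(* The inequality x *m c <= b is valid on P; c = 0 is allowed, with b = 1 it
   gives the empty face and with b = 0 the face P itself. *)
Definition is_face (R : realType) (n : nat) (P F : set 'rV[R]_n) : Prop :=
  exists (c : 'cV[R]_n) (b : R),
    (forall x, P x -> (x *m c) 0 0 <= b) /\
    F = [set x | P x /\ (x *m c) 0 0 = b].

(* fset_set is the empty set on infinite sets, but a polytope has only finitely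
   many faces. The vertices are the 0-dimensional faces. *)
Definition fnum (R : realType) (n : nat) (m : nat) (P : set 'rV[R]_n) : nat :=
  #|` fset_set [set F | is_face P F /\ has_dim F m] |.

(* Isomorphism of the face lattices. *)
Definition comb_equiv (R : realType) (n n' : nat)
    (P : set 'rV[R]_n) (Q : set 'rV[R]_n') : Prop :=
  exists f : set 'rV[R]_n -> set 'rV[R]_n',
    set_bij [set F | is_face P F] [set G | is_face Q G] f /\
    forall F G, is_face P F -> is_face P G -> (F `<=` G <-> f F `<=` f G).

(* The (k-1)-dimensional simplex on the k unit vectors of R^k. *)
Definition std_simplex (R : realType) (k : nat) : set 'rV[R]_k :=
  conv_hull (range (fun i : 'I_k => delta_mx 0 i)).
Arguments std_simplex R k : clear implicits.

Definition segment01 (R : realType) : set 'rV[R]_1 :=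
  conv_hull [set (0 : 'rV[R]_1); const_mx 1].
Arguments segment01 R : clear implicits.

Definition cart_prod (R : realType) (n1 n2 : nat)
    (A : set 'rV[R]_n1) (B : set 'rV[R]_n2) : set 'rV[R]_(n1 + n2) :=
  [set z | A (lsubmx z) /\ B (rsubmx z)].

Definition simplicial_prism (R : realType) (k : nat) : set 'rV[R]_(k + 1) :=
  cart_prod (std_simplex R k) (segment01 R).
Arguments simplicial_prism R k : clear implicits.

(* Q is placed in the hyperplane of height 0 and the apex (1, 0) outside it. *)
Definition pyramid (R : realType) (n : nat) (Q : set 'rV[R]_n) :
    set 'rV[R]_(1 + n) :=
  conv_hull ([set row_mx 0 x | x in Q] `|` [set row_mx (const_mx 1) 0]).

Fixpoint fold_pyramid (R : realType) (n : nat) (j : nat) (Q : set 'rV[R]_n) :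
    set 'rV[R]_(j + n) :=
  match j with
  | 0 => Q
  | j'.+1 => pyramid (@fold_pyramid R n j' Q)
  end.
Arguments fold_pyramid {R n} j Q.

(* M_{k,j}, of dimension k + j. *)
Definition triplex_model (R : realType) (k j : nat) : set 'rV[R]_(j + (k + 1)) :=
  fold_pyramid j (simplicial_prism R k).
Arguments triplex_model R k j : clear implicits.

Definition is_triplex (R : realType) (n d k : nat) (P : set 'rV[R]_n) : Prop :=
  comb_equiv P (triplex_model R k (d - k)).

(* The subtraction 2d + 1 - v is truncated; for v <= 2d + 1 it is exact. *)
Definition phi (m v d : nat) : int :=
  ('C(d + 1, m + 1))%:Z + ('C(d, m + 1))%:Z
    - ('C(2 * d + 1 - v, m + 1))%:Z.

(* Main.v *)
(* The proof follows Xue. Faces are identified with sets of vertices, ranked by dimension + 1.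
   Given vertices v_1, ..., v_r, r <= d, there are faces F_i of dimension d - i + 1 containing v_i but
   not v_1, ..., v_(i-1), and F_i has at least C(d - i + 1, m) m-faces through v_i; so at least
   \sum_i C(d - i + 1, m) m-faces meet {v_1, ..., v_r}. If P is not a simplex, some facet H misses at
   least two vertices; adding the m-faces of H (induction on d) to those meeting the missed vertices
   gives f_m(P) >= phi_m, by convexity of binomial coefficients.
   In the case of equality every such H misses either 2 or k vertices, and the missed vertices are
   simple and pairwise adjacent. Hence every vertex is simple or an apex over all the other vertices;
   counting edges across H and then incidences gives d - k apexes and a facet missing exactly k
   vertices, which serves as one base of the prism, and all facets can then be listed. *)

(* Ranking by dimension + 1 gives the empty face rank 0 and, once a point x is lifted to (1, x),
   makes the rank of a face the dimension of a linear span. The combinatorial part sees only the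
   axioms of [vertex_faces]. Vertex figures are never built: the interval above a vertex replaces
   them, and a vertex is simple when this interval is boolean. The equality case needs no induction
   on the dimension. For every facet missing at least two vertices the whole chain of inequalities
   collapses, and what is used is not the shape of that facet but the fact that as few faces as
   possible meet the missed vertices. This minimality passes to subsets: one missed vertex gives
   simplicity, two give adjacency. *)
From mathcomp Require Import all_boot.
From mathcomp Require Import zify.

Set Implicit Arguments.
Unset Strict Implicit.
Unset Printing Implicit Defensive.

(* [lia] also translates every boolean hypothesis, such as set inclusions, which makes it
   very slow here; [nlia] keeps only the arithmetic ones. *)
Ltac nlia :=
  repeat match goal with H : ?P |- _ =>
    match type of P with Prop =>
      lazymatch P with
      | is_true (leq _ _) => fail
      | is_true (andb (leq _ _) (leq _ _)) => fail
      | is_true (~~ (leq _ _)) => fail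
      | ~ is_true (leq _ _) => fail
      | @eq nat _ _ => fail
      | @eq ?U ?x ?y => tryif unify U nat then change (@eq nat x y) in H else clear H
      | is_true (@eq_op ?U _ _) => tryif unify U (nat : eqType) then fail else clear H
      | is_true (~~ (@eq_op ?U _ _)) => tryif unify U (nat : eqType) then fail else clear H
      | _ => clear H
      end
    end
  end; lia.

(* [rf_gap] holds both the gradedness of the face lattice (some face lies strictly between faces
   whose ranks differ by at least 2) and the diamond property (then there are two of them). *)
Record ranked_faces (T : finType) (F : {set {set T}}) (rk : {set T} -> nat) : Prop := {
  rf_top : setT \in F;
  rf_meet : forall A B, A \in F -> B \in F -> A :&: B \in F;
  rf_mono : forall A B, A \in F -> B \in F -> A \proper B -> rk A < rk B;
  rf_gap : forall A B, A \in F -> B \in F -> A \proper B -> rk A + 2 <= rk B ->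
    exists K L, [/\ K \in F, L \in F, A \proper K /\ A \proper L,
      K \proper B /\ L \proper B & K :&: L = A]
}.

(** * Intervals of a ranked face family: atoms, coatoms and level counts *)

Section Intervals.
Variables (T : finType) (F : {set {set T}}) (rk : {set T} -> nat).
Hypothesis rfF : ranked_faces F rk.
Implicit Types (A B E G H K X Y : {set T}).

Definition level E G j := [set K in F | [&& E \subset K, K \subset G & rk K == rk E + j]].
Definition atoms E G := level E G 1.
Definition coatoms E G := [set K in F | [&& E \subset K, K \subset G & (rk K).+1 == rk G]].
(** A coatom misses at most one atom. Between a vertex and the whole polytope this says that the
    vertex figure is a simplex, i.e. that the vertex is simple. *)
Definition boolean_interval E G := forall H a b,
  H \in coatoms E G -> a \in atoms E G -> b \in atoms E G ->
  ~~ (a \subset H) -> ~~ (b \subset H) -> a = b.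

Lemma rk_le A B : A \in F -> B \in F -> A \subset B -> rk A <= rk B.
Proof.
move=> AF BF; rewrite subEproper => /orP[/eqP->//|AB].
exact: ltnW (rf_mono rfF _ _ AB).
Qed.

Lemma rk_eq A B : A \in F -> B \in F -> A \subset B -> rk B <= rk A -> A = B.
Proof.
move=> AF BF; rewrite subEproper => /orP[/eqP->//|AB].
by rewrite leqNgt (rf_mono rfF).
Qed.

(** Take a face of maximal rank in the interval that does not contain [X]. If it were not a coatom,
    it would be the meet of two larger faces below [G]; both contain [X] by maximality, hence so
    does the meet. *)
Lemma coatom_avoiding E G X : E \in F -> G \in F -> E \subset G ->
  X \subset G -> ~~ (X \subset E) -> exists2 H, H \in coatoms E G & ~~ (X \subset H).
Proof.
move=> EF GF EG XG XE.
pose P K := [&& K \in F, E \subset K, K \subset G & ~~ (X \subset K)].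
have PE : P E by rewrite /P EF subxx EG.
case: (arg_maxnP rk PE) => H /and4P[HF EH HG XH] Hmax.
exists H => //; rewrite inE HF EH HG /= eqn_leq.
have HpG : H \proper G by rewrite properEneq HG andbT; apply: contraNneq XH => ->.
rewrite (rf_mono rfF) //= leqNgt; apply/negP => gap.
have [|K [L [KF LF [HK HL] [KG LG] KL]]] := rf_gap rfF HF GF HpG; first by nlia.
have big M : M \in F -> H \proper M -> M \proper G -> X \subset M.
  move=> MF HM MG; apply: contraT => XM.
  have := Hmax M; rewrite /P MF XM (subset_trans EH (proper_sub HM)) (proper_sub MG).
  by move=> /(_ isT); have := rf_mono rfF HF MF HM; nlia.
by case/negP: XH; rewrite -KL subsetI !big.
Qed.

(** Atomicity of the lattice. Take [K] of minimal rank not inside [Y] and suppose it is not an atom.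
    If [K :&: Y] is [E], a face strictly between [E] and [K] lies in [Y] by minimality, which is
    absurd. Otherwise some coatom of [E, K] does not contain [K :&: Y]; by minimality it lies inside
    [K :&: Y], and comparing ranks makes the two equal. *)
Lemma atom_not_sub E G Y : E \in F -> G \in F -> Y \in F -> E \subset G ->
  E \subset Y -> ~~ (G \subset Y) -> exists2 a, a \in atoms E G & ~~ (a \subset Y).
Proof.
move=> EF GF YF EG EY GY.
pose P K := [&& K \in F, E \subset K, K \subset G & ~~ (K \subset Y)].
have PG : P G by rewrite /P GF subxx EG.
case: (arg_minnP rk PG) => K /and4P[KF EK KG KY] Kmin.
exists K => //; rewrite inE KF EK KG /= addn1 eqn_leq.
have EpK : E \proper K.
  by rewrite properEneq EK andbT; apply: contraNneq KY => <-.
rewrite (rf_mono rfF) // andbT leqNgt; apply/negP => gap.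
have Kmin' M : M \in F -> E \subset M -> M \proper K -> M \subset Y.
  move=> MF EM MK; apply: contraT => MY.
  have := Kmin M; rewrite /P MF EM MY (subset_trans (proper_sub MK) KG).
  by move=> /(_ isT); have := rf_mono rfF MF KF MK; nlia.
set Z := K :&: Y.
have ZF : Z \in F by apply: (rf_meet rfF).
have ZK : Z \proper K by rewrite properEneq subsetIl andbT; apply: contraNneq KY => /setIidPl.
have EZ : E \subset Z by rewrite subsetI EK.
have [ZE|ZnE] := boolP (Z \subset E).
  have [|L [M [LF MF [EL EM] [LK MK] _]]] := rf_gap rfF EF KF EpK; first by nlia.
  have LZ : L \subset Z by rewrite subsetI (proper_sub LK) Kmin' // proper_sub.
  by have := proper_sub_trans EL (subset_trans LZ ZE); rewrite properxx.
have [H] := coatom_avoiding EF KF EK (proper_sub ZK) ZnE.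
rewrite inE => /and4P[HF EH HK /eqP rH] ZH.
have HpK : H \proper K by rewrite properEneq HK andbT; apply/eqP => eHK; move: rH; rewrite eHK; nlia.
have HZ : H \subset Z by rewrite subsetI HK Kmin'.
have := rk_eq HF ZF HZ; have := rf_mono rfF ZF KF ZK; rewrite -rH ltnS => /[swap] /[apply] eHZ.
by rewrite eHZ subxx in ZH.
Qed.

Lemma coatom_exists E G : E \in F -> G \in F -> E \proper G ->
  exists H, H \in coatoms E G.
Proof.
move=> EF GF /properP[EG [x xG xE]].
have [||H HC _] := @coatom_avoiding E G [set x] EF GF EG; [by rewrite sub1set..|].
by exists H.
Qed.

Lemma levelS E G G' j : G \subset G' -> level E G j \subset level E G' j.
Proof.
move=> GG'; apply/subsetP => K; rewrite !inE => /and4P[-> -> KG ->].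
by rewrite (subset_trans KG).
Qed.

(** Pascal's rule: choose a coatom [H] and an atom [a] not below it; the faces below [H] and the
    faces above [a] are disjoint families. *)
Lemma leq_card_level E G j : E \in F -> G \in F -> E \subset G ->
  'C(rk G - rk E, j) <= #|level E G j|.
Proof.
move: {2}(rk G - rk E) (erefl (rk G - rk E)) => r.
elim: r E G j => [|r IH] E G j rEG EF GF EG.
  rewrite rEG bin0n; case: j => [|j] //; apply/card_gt0P; exists E.
  by rewrite inE EF subxx EG addn0 /=.
rewrite rEG.
case: j => [|j].
  rewrite bin0; apply/card_gt0P; exists E.
  by rewrite inE EF subxx EG addn0 /=.
have EpG : E \proper G.
  by rewrite properEneq EG andbT; apply/eqP => e; move: rEG; rewrite e; nlia.
have [H] := coatom_exists EF GF EpG; rewrite inE => /and4P[HF EH HG /eqP rH].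
have [|a] := atom_not_sub EF GF HF EG EH.
  by apply/negP => GH; have := rk_le GF HF GH; nlia.
rewrite inE => /and4P[aF Ea aG /eqP ra] aH.
have rH' : rk H - rk E = r by nlia.
have ra' : rk G - rk a = r by nlia.
have := IH E H j.+1 rH' EF HF EH.
have := IH a G j ra' aF GF aG.
rewrite rH' ra' binS => h1 h2; apply: leq_trans (leq_add h2 h1) _.
rewrite -cardsUI (_ : _ :&: _ = set0) ?cards0 ?addn0; last first.
  apply/setP => K; rewrite !inE; apply/negbTE/negP.
  by move=> /andP[/and4P[_ _ KH _] /and4P[_ aK _ _]]; rewrite (subset_trans aK) in aH.
apply/subset_leq_card; apply/subsetP => K; rewrite !inE.
case/orP => /and4P[-> EK KG /eqP rK].
  by rewrite EK (subset_trans KG HG) rK eqxx.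
by rewrite (subset_trans Ea EK) KG rK ra; apply/eqP; nlia.
Qed.

Lemma level_neq0 E G j : E \in F -> G \in F -> E \subset G ->
  j <= rk G - rk E -> exists K, K \in level E G j.
Proof.
move=> EF GF EG jle; apply/card_gt0P.
by apply: leq_trans (leq_card_level _ EF GF EG); rewrite bin_gt0.
Qed.

Lemma atoms_inj E G H K : E \in F -> H \in F -> K \in F -> E \subset H -> E \subset K ->
  H \subset G ->
  (forall a, a \in atoms E G -> a \subset H -> a \subset K) -> H \subset K.
Proof.
move=> EF HF KF EH EK HG sub; apply: contraT => HK.
have [a] := atom_not_sub EF HF KF EH EK HK; rewrite inE => /and4P[aF Ea aH ra].
by rewrite sub // inE aF Ea (subset_trans aH).
Qed.

(** A coatom of the big interval that misses an atom [a] of [K] contains all the other atoms, so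
    meeting [K] with it lowers the rank and loses only [a]. *)
Lemma card_atoms_le E G K :
  E \in F -> G \in F -> E \subset G ->
  boolean_interval E G ->
  K \in F -> E \subset K -> K \subset G ->
  #|atoms E K| <= rk K - rk E.
Proof.
move=> EF GF EG one.
elim: {K}_.+1 {-2}K (ltnSn (rk K)) => // n IH K rKn KF EK KG.
have [|/set0Pn[a aK]] := eqVneq (atoms E K) set0; first by move->; rewrite cards0.
have aG : a \in atoms E G by apply: (subsetP (levelS _ _ KG)).
have := aK; rewrite inE => /and4P[aF Ea asK /eqP ra].
have [||H HC aH] := @coatom_avoiding E G a EF GF EG.
- exact: subset_trans asK KG.
- by apply/negP => h; have := rk_le aF EF h; nlia.
have := HC; rewrite inE => /and4P[HF EH HG rH].
have KHF : K :&: H \in F by exact: (rf_meet rfF KF HF).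
have EKH : E \subset K :&: H by rewrite subsetI EK EH.
have KHpK : K :&: H \proper K.
  rewrite properEneq subsetIl andbT; apply: contraNneq aH => /setIidPl.
  exact: subset_trans.
have := rf_mono rfF KHF KF KHpK => lt.
have := IH (K :&: H); rewrite KHF EKH (subset_trans (subsetIl _ _) KG).
move=> /(_ _ isT isT isT) le.
have {le} : #|atoms E (K :&: H)| <= rk (K :&: H) - rk E by apply: le; nlia.
have := rk_le EF KHF EKH.
suff -> : atoms E (K :&: H) = atoms E K :\ a.
  by rewrite (cardsD1 a (atoms E K)) aK; nlia.
apply/setP => b; rewrite !inE subsetI.
have [->|ba] /= := eqVneq b a.
  by rewrite (negPf aH) andbF /= !andbF.
case bF: (b \in F) => //=; case Eb: (E \subset b) => //=.
case bK: (b \subset K) => //=; case rb: (rk b == rk E + 1); rewrite ?andbF //= ?andbT.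
apply: contraTT ba => bH; rewrite negbK; apply/eqP; apply: (one H) => //.
by rewrite inE bF Eb rb (subset_trans bK).
Qed.

(* Three disjoint families: faces below [H], faces above [a], faces above [b] but not above [a]. *)
Lemma card_level_gt E G H a b j :
  E \in F -> G \in F -> E \subset G -> H \in coatoms E G ->
  a \in atoms E G -> b \in atoms E G -> a != b -> ~~ (a \subset H) -> ~~ (b \subset H) ->
  0 < j < rk G - rk E -> 'C(rk G - rk E, j) < #|level E G j|.
Proof.
move=> EF GF EG HC aA bA ab aH bH jr.
have := HC; rewrite inE => /and4P[HF EH HG /eqP rH].
have := aA; rewrite inE => /and4P[aF Ea aG /eqP ra].
have := bA; rewrite inE => /and4P[bF Eb bG /eqP rb].
have [|K KC aK] := @coatom_avoiding b G a bF GF bG aG.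
  by apply: contra_neqN ab => h; apply: rk_eq => //; rewrite ra rb.
have := KC; rewrite inE => /and4P[KF bK KG /eqP rK].
case: j jr => // j /andP[_ jr].
have h1 := leq_card_level j.+1 EF HF EH.
have h2 := leq_card_level j aF GF aG.
have h3 := leq_card_level j bF KF bK.
have : 0 < 'C(rk K - rk b, j) by rewrite bin_gt0; nlia.
have e1 : rk H - rk E = (rk G - rk E).-1 by nlia.
have e2 : rk G - rk a = (rk G - rk E).-1 by nlia.
rewrite e1 in h1; rewrite e2 in h2.
have -> : 'C(rk G - rk E, j.+1) = 'C((rk G - rk E).-1, j.+1) + 'C((rk G - rk E).-1, j).
  by rewrite -binS prednK //; nlia.
suff : #|level E H j.+1| + #|level a G j| + #|level b K j| <= #|level E G j.+1| by nlia.
have disj (X Y Z : {set {set T}}) : X \subset Z -> Y \subset Z -> X :&: Y = set0 ->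
    #|X| + #|Y| = #|X :|: Y| /\ X :|: Y \subset Z.
  by move=> XZ YZ XY; rewrite -cardsUI XY cards0 addn0 subUset XZ YZ.
have sH : level E H j.+1 \subset level E G j.+1 by exact: levelS.
have sa : level a G j \subset level E G j.+1.
  apply/subsetP => M; rewrite !inE => /and4P[-> aM -> /eqP->].
  by rewrite (subset_trans Ea aM) /= ra; apply/eqP; nlia.
have sb : level b K j \subset level E G j.+1.
  apply/subsetP => M; rewrite !inE => /and4P[-> bM MK /eqP->].
  by rewrite (subset_trans Eb bM) (subset_trans MK) //= rb; apply/eqP; nlia.
have [|-> s1] := disj _ _ _ sH sa.
  apply/setP => M; rewrite !inE; apply/negP => /andP[/and4P[_ _ MH _] /and4P[_ aM _ _]].
  by rewrite (subset_trans aM) in aH.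
have [|-> s2] := disj _ _ _ s1 sb; last exact: subset_leq_card.
apply/setP => M; rewrite !inE; apply/negP => /andP[].
case/orP => /and4P[_ h h' _] /and4P[_ bM MK _].
  by rewrite (subset_trans bM) in bH.
by rewrite (subset_trans h) in aK.
Qed.

Lemma boolean_intervalI E G j :
  E \in F -> G \in F -> E \subset G -> 0 < j < rk G - rk E ->
  #|level E G j| <= 'C(rk G - rk E, j) ->
  boolean_interval E G.
Proof.
move=> EF GF EG jr le H a b HC aA bA aH bH; apply/eqP; apply: contraLR le => ab.
by rewrite -ltnNge; apply: (card_level_gt _ _ _ HC aA bA).
Qed.

Lemma card_atoms_boolean E G :
  E \in F -> G \in F -> E \subset G ->
  boolean_interval E G ->
  #|atoms E G| = rk G - rk E.
Proof.
move=> EF GF EG one; apply/eqP; rewrite eqn_leq (card_atoms_le EF GF EG one) //=.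
by have := leq_card_level 1 EF GF EG; rewrite bin1.
Qed.

Lemma coatom_misses E G H : E \in F -> G \in F -> E \subset G -> H \in coatoms E G ->
  exists2 a, a \in atoms E G & ~~ (a \subset H).
Proof.
move=> EF GF EG; rewrite inE => /and4P[HF EH HG /eqP rH].
apply: atom_not_sub => //; apply/negP => GH.
by have := rk_le GF HF GH; nlia.
Qed.

Lemma coatom_eq E G H K a :
  E \in F -> G \in F -> E \subset G ->
  boolean_interval E G ->
  H \in coatoms E G -> K \in coatoms E G -> a \in atoms E G ->
  ~~ (a \subset H) -> ~~ (a \subset K) -> H = K.
Proof.
move=> EF GF EG one.
wlog suff : H K / H \in coatoms E G -> K \in coatoms E G -> a \in atoms E G ->
  ~~ (a \subset H) -> ~~ (a \subset K) -> H \subset K.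
  by move=> W HC KC aA aH aK; apply/eqP; rewrite eqEsubset (W H K) // (W K H).
move=> HC KC aA aH aK.
have := HC; rewrite inE => /and4P[HF EH HG /eqP rH].
have := KC; rewrite inE => /and4P[KF EK KG /eqP rK].
apply: (@atoms_inj E G) => // b bA bH; apply: contraT => bK.
by rewrite -(one K b a) // bH in aH.
Qed.

(** Sending a coatom to the atom it misses is a bijection onto the atoms. *)
Lemma card_coatoms_boolean E G :
  E \in F -> G \in F -> E \subset G ->
  boolean_interval E G ->
  #|coatoms E G| = rk G - rk E.
Proof.
move=> EF GF EG one; rewrite -card_atoms_boolean //.
have miss H : exists a, (H \in coatoms E G) ==> (a \in atoms E G) && ~~ (a \subset H).
  have [HC|_] := boolP (H \in coatoms E G); last by exists set0.
  by have [a aA aH] := coatom_misses EF GF EG HC; exists a; rewrite aA.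
pose f H := xchoose (miss H).
have fP H : H \in coatoms E G -> f H \in atoms E G /\ ~~ (f H \subset H).
  by move=> HC; have /implyP/(_ HC)/andP := xchooseP (miss H).
have fI : {in coatoms E G &, injective f}.
  move=> H K HC KC e; have [aA aH] := fP _ HC; have [_ aK] := fP _ KC.
  by apply: (coatom_eq _ _ _ one _ _ aA) => //; rewrite e.
rewrite -(card_in_imset fI); congr #|pred_of_set _|; apply/setP => a.
apply/imsetP/idP => [[H HC ->]|aA]; first by have [] := fP _ HC.
have := aA; rewrite inE => /and4P[aF Ea aG /eqP ra].
have [|H HC aH] := coatom_avoiding EF GF EG aG.
  by apply/negP => h; have := rk_le aF EF h; nlia.
by exists H => //; have [fA fH] := fP _ HC; apply: (one H).
Qed.

End Intervals.

(** * Binomial coefficients *)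

Lemma bin_convex a p q n : 'C(a + p, n) + 'C(a + q, n) <= 'C(a + p + q, n) + 'C(a, n).
Proof.
case: n => [|n]; first by rewrite !bin0.
elim: q => [|q IH]; first by rewrite !addn0 addnC addnC.
rewrite !addnS !binS.
have /(leq_bin2l n) : a + q <= a + p + q by lia.
by nlia.
Qed.

Lemma bin_ltn a b n : 0 < n <= b -> a < b -> 'C(a, n) < 'C(b, n).
Proof.
case: n => // n /andP[_ nb] ab; case: b nb ab => // b; rewrite !ltnS binS => nb ab.
have := leq_bin2l n.+1 ab; have : 0 < 'C(b, n) by rewrite bin_gt0.
by lia.
Qed.

Lemma bin_strict_convex a p q n : 0 < p -> 0 < q -> 0 < n <= a + p + q.-1 ->
  'C(a + p, n.+1) + 'C(a + q, n.+1) < 'C(a + p + q, n.+1) + 'C(a, n.+1).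
Proof.
move=> p0; case: q => // q _ /= nq; rewrite !addnS !binS.
have := bin_convex a p q n.+1.
by have := @bin_ltn (a + q) (a + p + q) n nq; rewrite ltn_add2r -addn1 leq_add2l => /(_ p0); nlia.
Qed.

Lemma hockey_stick d m r : r <= d.+1 ->
  \sum_(0 <= i < r) 'C(d - i, m) + 'C(d.+1 - r, m.+1) = 'C(d.+1, m.+1).
Proof.
elim: r => [|r IH] rd; first by rewrite big_geq // subn0.
rewrite big_nat_recr //= -IH ?(ltnW rd) //.
by rewrite subSS subSn // binS; nlia.
Qed.

(** * The lower bound *)

(** [rf_gap] only gives at least two atoms below a face of rank 2; [vf_edge] adds that an edge has
    no third vertex. *)
Record vertex_faces (T : finType) (F : {set {set T}}) (rk : {set T} -> nat) : Prop := {
  vf_ranked : ranked_faces F rk;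
  vf_bot : set0 \in F;
  vf_rk0 : rk set0 = 0;
  vf_vertex : forall x, [set x] \in F;
  vf_rk1 : forall x, rk [set x] = 1;
  vf_edge : forall A, A \in F -> rk A = 2 -> #|A| = 2
}.

Section Vertices.
Variables (T : finType) (F : {set {set T}}) (rk : {set T} -> nat).
Hypothesis vfF : vertex_faces F rk.
Let rfF := vf_ranked vfF.
Implicit Types (G H K S U : {set T}) (v w x : T).

Lemma rk1P K : K \in F -> rk K = 1 -> exists x, K = [set x].
Proof.
move=> KF rK; have [K0|[x xK]] := set_0Vmem K; first by rewrite K0 (vf_rk0 vfF) in rK.
exists x; apply/esym/(rk_eq rfF (vf_vertex vfF x) KF); first by rewrite sub1set.
by rewrite rK (vf_rk1 vfF).
Qed.

Lemma card_atoms_vertices G : #|atoms F rk set0 G| = #|G|.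
Proof.
rewrite -(card_imset (mem G) (@set1_inj T)); congr #|pred_of_set _|; apply/setP => K.
rewrite !inE sub0set (vf_rk0 vfF) /=; apply/and3P/imsetP.
  by case=> KF KG /eqP rK; have [x e] := rk1P KF rK; exists x; rewrite // -sub1set -e.
by case=> x xG ->; rewrite (vf_vertex vfF) sub1set (vf_rk1 vfF).
Qed.

Lemma rk_le_card G : G \in F -> rk G <= #|G|.
Proof.
move=> GF; have := leq_card_level rfF 1 (vf_bot vfF) GF (sub0set _).
by rewrite (vf_rk0 vfF) subn0 bin1 card_atoms_vertices.
Qed.

Definition meeting G S j := [set K in F | [&& K \subset G, rk K == j & ~~ [disjoint K & S]]].

(** The vertices of [S] are removed one at a time. Each time the current face is replaced by a
    coatom above [v]: one avoiding [x] if [x] is still present, any one otherwise, so that the rank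
    drops by exactly one. *)
Lemma face_avoiding G S v : G \in F -> S \subset G -> v \in G -> v \notin S -> #|S| < rk G ->
  exists H, [/\ H \in F, v \in H, H \subset G, rk H = rk G - #|S| & [disjoint H & S]].
Proof.
move=> GF; move: {2}#|S| (erefl #|S|) => r.
elim: r S => [|r IH] S rS SG vG vS lt.
  move/eqP: rS; rewrite cards_eq0 => /eqP ->; exists G.
  by rewrite cards0 subn0 disjoint_sym disjoints_subset sub0set.
have /set0Pn[x xS] : S != set0 by rewrite -cards_eq0 rS.
have rS' : #|S :\ x| = r by move: rS; rewrite (cardsD1 x) xS => -[].
have [||||H [HF vH HG rH dH]] := IH (S :\ x) rS'.
- exact: subset_trans (subsetDl _ _) SG.
- by [].
- by rewrite !inE negb_and vS orbT.
- by rewrite rS'; nlia.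
have vx : x != v by apply: contraNneq vS => <-.
have vHs : [set v] \subset H by rewrite sub1set.
have fin K : K \in coatoms F rk [set v] H -> x \notin K -> exists H0 : {set T},
     [/\ H0 \in F, v \in H0, H0 \subset G, rk H0 = rk G - #|S| & [disjoint H0 & S]].
  rewrite inE sub1set => /and4P[KF vK KH /eqP rK] xK; exists K; split => //.
  - exact: subset_trans HG.
  - by rewrite rS; nlia.
  rewrite disjoints_subset; apply/subsetP => y yK; rewrite inE.
  have := disjointFr dH (subsetP KH _ yK); rewrite !inE => /negbT.
  by rewrite negb_and negbK => /orP[/eqP e|//]; rewrite -e yK in xK.
have [xH|xH] := boolP (x \in H).
  have [|| K KC xK] := coatom_avoiding rfF (X := [set x]) (vf_vertex vfF v) HF vHs.
  - by rewrite sub1set.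
  - by rewrite sub1set inE.
  by apply: fin KC _; rewrite -sub1set.
have [|K KC] := coatom_exists rfF (vf_vertex vfF v) HF.
  rewrite properEneq vHs andbT; apply/eqP => e.
  by move: rH; rewrite -e (vf_rk1 vfF) rS'; nlia.
apply: fin (KC) _; apply: contraNN xH.
by move: KC; rewrite inE => /and4P[_ _ /subsetP sub _] /sub.
Qed.

(** The faces through [v] inside a face that avoids [S] are all new. *)
Lemma card_meetingU1 G S v m : G \in F -> S \subset G -> v \in G -> v \notin S -> #|S| < rk G ->
  #|meeting G S m.+1| + 'C((rk G).-1 - #|S|, m) <= #|meeting G (v |: S) m.+1|.
Proof.
move=> GF SG vG vS lt.
have [H [HF vH HG rH dH]] := face_avoiding GF SG vG vS lt.
have vHs : [set v] \subset H by rewrite sub1set.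
have := leq_card_level rfF m (vf_vertex vfF v) HF vHs.
rewrite (vf_rk1 vfF) rH (_ : _ - 1 = (rk G).-1 - #|S|); last by nlia.
rewrite -(leq_add2l #|meeting G S m.+1|) => /leq_trans; apply.
rewrite -cardsUI (_ : _ :&: _ = set0) ?cards0 ?addn0.
  apply/subset_leq_card/subsetP => K; rewrite !inE sub1set.
  case/orP => [/and4P[-> -> -> h]|/and4P[-> vK KH /eqP->]] /=.
    by apply: contraNN h => /disjointWr; apply; apply: subsetUr.
  rewrite (subset_trans KH) //= (vf_rk1 vfF) add1n eqxx /=.
  by apply/negP => /disjoint_setI0/setP/(_ v); rewrite !inE vK eqxx.
apply/setP => K; rewrite !inE; apply/negP => /andP[/and4P[_ _ _ /negP h] /and4P[_ _ KH _]].
by apply: h; apply: disjointWl dH.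
Qed.

Lemma leq_card_meeting G S U m : G \in F -> S \subset U -> U \subset G -> #|U| <= rk G ->
  #|meeting G S m.+1| + \sum_(#|S| <= i < #|U|) 'C((rk G).-1 - i, m)
    <= #|meeting G U m.+1|.
Proof.
move=> GF; move: {2}(#|U :\: S|) (erefl #|U :\: S|) => r.
elim: r U => [|r IH] U rU SU UG lt.
  have -> : U = S by apply/eqP; rewrite eqEsubset SU -setD_eq0 -cards_eq0 rU.
  by rewrite big_geq // addn0.
have /set0Pn[v] : U :\: S != set0 by rewrite -cards_eq0 rU.
rewrite inE => /andP[vS vU].
have cU : #|U| = #|U :\ v|.+1 by rewrite (cardsD1 v) vU.
have SU' : S \subset U :\ v by rewrite subsetD1 SU vS.
have UG' : U :\ v \subset G by apply: subset_trans (subsetDl _ _) UG.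
have h1 : #|meeting G S m.+1| + \sum_(#|S| <= i < #|U :\ v|) 'C((rk G).-1 - i, m)
    <= #|meeting G (U :\ v) m.+1|.
  apply: IH => //; last by nlia.
  move: rU; rewrite (cardsD1 v) inE vS vU => -[<-]; congr #|pred_of_set _|.
  by rewrite !setDDl setUC.
have := @card_meetingU1 G (U :\ v) v m GF UG' (subsetP UG _ vU).
rewrite !inE eqxx /= => /(_ isT); rewrite setD1K // => h2.
have {}h2 : #|meeting G (U :\ v) m.+1| + 'C((rk G).-1 - #|U :\ v|, m) <= #|meeting G U m.+1|.
  by apply: h2; nlia.
rewrite cU big_nat_recr ?subset_leq_card //= addnA.
by apply: leq_trans h2; rewrite leq_add2r.
Qed.

Lemma card_level_facet G H m : H \in F -> G \in F -> H \subset G ->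
  #|level F rk set0 G m.+1| = #|level F rk set0 H m.+1| + #|meeting G (G :\: H) m.+1|.
Proof.
move=> HF GF HG; rewrite -cardsUI (_ : _ :&: _ = set0) ?cards0 ?addn0.
  congr #|pred_of_set _|; apply/setP => K; rewrite !inE sub0set (vf_rk0 vfF) add0n /=.
  case: (K \in F) => //=; case: (rk K == _); rewrite ?andbF ?andbT //=.
  have [KG|KG] /= := boolP (K \subset G); last first.
    by rewrite orbF; apply/esym/negP => h; rewrite (subset_trans h HG) in KG.
  rewrite disjoints_subset; case: (boolP (K \subset H)) => //= KH.
  apply/esym/negP => /subsetP h; case/negP: KH; apply/subsetP => x xK.
  by have := h x xK; rewrite !inE (subsetP KG _ xK) andbT negbK.
apply/setP => K; rewrite !inE; apply/negP => /andP[/and4P[_ _ KH _] /and4P[_ _ _ /negP]]; apply.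
rewrite disjoints_subset; apply/subsetP => x xK.
by rewrite !inE negb_and negbK (subsetP KH).
Qed.

Definition facets G := coatoms F rk set0 G.

Lemma facetP G H : reflect [/\ H \in F, H \subset G & (rk H).+1 = rk G] (H \in facets G).
Proof.
rewrite inE sub0set /=; apply: (iffP and3P) => -[? ? /eqP ?]; split=> //; exact/eqP.
Qed.

(** If every facet missed at most one vertex, the interval from the empty face to [G] would be
    boolean and [G] would have only [rk G] vertices. *)
Lemma big_facet_exists G : G \in F -> rk G < #|G| ->
  exists2 H, H \in facets G & 1 < #|G :\: H|.
Proof.
move=> GF lt.
have [/exists_inP[H HG HU]|no] := boolP [exists H in facets G, 1 < #|G :\: H|]; first by exists H.
suff : #|atoms F rk set0 G| <= rk G - rk set0.
  by rewrite card_atoms_vertices (vf_rk0 vfF); nlia.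
rewrite (card_atoms_boolean rfF (vf_bot vfF) GF (sub0set _)) // => H a b HG.
rewrite !inE !sub0set (vf_rk0 vfF) /= => /and3P[aF aG /eqP ra] /and3P[bF bG /eqP rb] aH bH.
have [x ex] := rk1P aF ra; have [y ey] := rk1P bF rb; subst a b.
rewrite !sub1set in aG bG aH bH; congr [set _]; apply/eqP; apply: contraT => xy.
case/negP: no; apply/exists_inP; exists H => //; apply/card_gt1P.
by exists x, y; rewrite !inE aG bG aH bH.
Qed.

(** [s] and [t] measure the excess of vertices over dimension, for [G] of dimension d + 1 and [H] of
    dimension d; the facet misses s - t + 1 vertices. *)
Lemma facet_count d s t m G H :
  G \in F -> H \in facets G -> rk G = d.+2 -> #|G| = d.+1 + s -> #|H| = d + t ->
  0 < t < s -> s <= d.+1 ->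
  [/\ #|level F rk set0 G m.+1| = #|level F rk set0 H m.+1| + #|meeting G (G :\: H) m.+1|,
   \sum_(0 <= i < #|G :\: H|) 'C(d.+1 - i, m) <= #|meeting G (G :\: H) m.+1|
  & \sum_(0 <= i < #|G :\: H|) 'C(d.+1 - i, m) + 'C((d.+2 - s) + t.-1, m.+1)
    = 'C(d.+2, m.+1) ].
Proof.
move=> GF /facetP[HF HG rH] rG cG cH tlt sd.
have cU : #|G :\: H| = s - t + 1.
  by have := cardsID H G; rewrite (setIidPr HG); nlia.
split; first exact: card_level_facet.
  have := @leq_card_meeting G set0 (G :\: H) m GF (sub0set _) (subsetDl _ _).
  rewrite cards0 rG cU => h; apply: leq_trans (h _); [exact: leq_addl|by nlia].
rewrite cU -(@hockey_stick d.+1 m (s - t + 1)); last by nlia.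
by congr (_ + 'C(_, _)); nlia.
Qed.

Theorem lower_bound d s m G : G \in F -> rk G = d.+1 -> #|G| = d + s -> 0 < s <= d ->
  'C(d.+1, m.+1) + 'C(d, m.+1) <= #|level F rk set0 G m.+1| + 'C(d.+1 - s, m.+1).
Proof.
elim: d s G => [|d IH] s G GF rG cG sd; first by nlia.
have [s1|s1] := leqP s 1.
  have -> : s = 1 by nlia.
  have := leq_card_level rfF m.+1 (vf_bot vfF) GF (sub0set _).
  by rewrite rG (vf_rk0 vfF) !subn0 subSS subn0 leq_add2r.
have [|H Hfac HU] := big_facet_exists GF; first by nlia.
have := Hfac => /facetP[HF HG rH].
have cU : #|H| + #|G :\: H| = #|G| by have := cardsID H G; rewrite (setIidPr HG).
have cH := rk_le_card HF.
have [t ct] : exists t, #|H| = d + t by exists (#|H| - d); nlia.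
have tlt : 0 < t < s by nlia.
have sd1 : s <= d.+1 by nlia.
have [-> h1 h2] := facet_count m GF Hfac rG cG ct tlt sd1.
have := IH t H HF _ ct; rewrite (_ : 0 < t <= d); last by nlia.
move=> /(_ _ isT) h3; have {}h3 := h3 ltac:(nlia).
(* What is left after the induction hypothesis is, with lower index m + 1 throughout, C(d + 1 - t) +
   C(d + 1 - s + t) <= C(d) + C(d + 2 - s): equal sums of upper arguments, the left pair lying
   between the right one. *)
have := bin_convex (d.+2 - s) t.-1 (s - t).-1 m.+1.
rewrite (_ : d.+2 - s + t.-1 + (s - t).-1 = d); last by nlia.
rewrite (_ : d.+2 - s + (s - t).-1 = d.+1 - t); last by nlia.
by nlia.
Qed.

End Vertices.

(** * The case of equality *)

Section Neighbours.
Variables (T : finType) (F : {set {set T}}) (rk : {set T} -> nat).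
Hypothesis vfF : vertex_faces F rk.
Let rfF := vf_ranked vfF.
Implicit Types (A G H K S U : {set T}) (u v w x y : T).

Definition adj v w := (v != w) && ([set v; w] \in F).
Definition nbrs v := [set w | adj v w].

Lemma adjE v w : adj v w = (v != w) && ([set v; w] \in F).
Proof. by []. Qed.

Lemma adj_sym v w : adj v w = adj w v.
Proof. by rewrite /adj eq_sym setUC. Qed.

Lemma rk_edge v w : adj v w -> rk [set v; w] = 2.
Proof.
case/andP=> vw AF; have vA : [set v] \subset [set v; w] by rewrite sub1set !inE eqxx.
have vpA : [set v] \proper [set v; w].
  by rewrite properEcard vA cards1 cards2 vw.
have := rf_mono rfF (vf_vertex vfF v) AF vpA; rewrite (vf_rk1 vfF) => lt.
apply/eqP; rewrite eqn_leq lt andbT leqNgt; apply/negP => gt.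
have [|K [L [_ _ [vK _] [KA _] _]]] := rf_gap rfF (vf_vertex vfF v) AF vpA.
  by rewrite (vf_rk1 vfF).
have := proper_card vK; have := proper_card KA; rewrite cards1 cards2 vw; lia.
Qed.

Lemma adj_atomP v (e : {set T}) :
  reflect (exists2 w, adj v w & e = [set v; w]) (e \in atoms F rk [set v] setT).
Proof.
rewrite inE sub1set subsetT (vf_rk1 vfF) /=; apply: (iffP and3P).
  case=> eF ve /eqP re; have /eqP := vf_edge vfF eF re; rewrite eqn_leq => /andP[_ /card_gt1P].
  case=> x [y [xe ye xy]].
  have [w we wv] : exists2 w, w \in e & v != w.
    by have [vx|vx] := eqVneq v x; [exists y => //; rewrite vx|exists x].
  suff ee : e = [set v; w] by exists w => //; rewrite /adj wv -ee.
  apply/esym/eqP; rewrite eqEcard (vf_edge vfF eF re) cards2 wv andbT.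
  by apply/subsetP => z; rewrite !inE => /orP[] /eqP->.
case=> w vw ->; rewrite !inE eqxx (rk_edge vw); split=> //.
by case/andP: vw.
Qed.

Lemma set2_inj v : injective (fun w => [set v; w]).
Proof.
move=> x y /setP e; have := e x; have := e y.
by rewrite !inE !eqxx !orbT => /orP[]/eqP-> // /esym/orP[]/eqP->.
Qed.

Lemma card_nbrs v : #|nbrs v| = #|atoms F rk [set v] setT|.
Proof.
rewrite -(card_imset (mem (nbrs v)) (@set2_inj v)); congr #|pred_of_set _|.
apply/setP => e; apply/imsetP/adj_atomP => -[w]; first by rewrite inE; exists w.
by exists w; rewrite ?inE.
Qed.

Lemma facet_top H : (H \in facets F rk setT) = (H \in F) && ((rk H).+1 == rk setT).
Proof. by rewrite inE sub0set subsetT. Qed.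

Lemma facet_coatom H v : (H \in facets F rk setT) && (v \in H) = (H \in coatoms F rk [set v] setT).
Proof. by rewrite facet_top inE sub1set subsetT andbAC -andbA. Qed.

Lemma edge_sub v w H : v \in H -> ([set v; w] \subset H) = (w \in H).
Proof. by move=> vH; rewrite subUset !sub1set vH. Qed.

Lemma facet_at_avoiding v w : v != w -> exists H, [/\ H \in facets F rk setT, v \in H & w \notin H].
Proof.
move=> vw; have [|||H] := coatom_avoiding rfF (X := [set w]) (vf_vertex vfF v) (rf_top rfF).
- by rewrite subsetT.
- by rewrite subsetT.
- by rewrite sub1set inE eq_sym.
by rewrite -facet_coatom sub1set => /andP[HF vH] wH; exists H.
Qed.

Lemma facet_avoiding v : exists2 H, H \in facets F rk setT & v \notin H.
Proof.
have [|||H HC vH] := coatom_avoiding rfF (X := [set v]) (vf_bot vfF) (rf_top rfF).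
- by rewrite subsetT.
- by rewrite subsetT.
- by rewrite sub1set inE.
by exists H => //; rewrite -sub1set.
Qed.

Lemma facet_sub_eq H K : H \in facets F rk setT -> K \in facets F rk setT -> H \subset K -> H = K.
Proof.
rewrite !facet_top => /andP[HF /eqP rH] /andP[KF /eqP rK] HK.
by apply: (rk_eq rfF HF KF HK); nlia.
Qed.

(** Faces are closed under intersection, and [S] is the intersection of the faces containing it. *)
Lemma face_of_separation S :
  (forall y, y \notin S -> exists H, [/\ H \in F, S \subset H & y \notin H]) -> S \in F.
Proof.
move=> sep; suff -> : S = \bigcap_(H in F | S \subset H) H.
  by elim/big_rec: _ => [|H K /andP[HF _] KF]; [exact: rf_top rfF|exact: (rf_meet rfF)].
apply/eqP; rewrite eqEsubset; apply/andP; split.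
  by apply/bigcapsP => H /andP[].
apply/subsetP => y /bigcapP cap; apply: contraT => /sep[H [HF SH /negP[]]].
by apply: cap; rewrite HF.
Qed.

Lemma facet_containing S y : S \in F -> y \notin S ->
  exists2 H, H \in facets F rk setT & S \subset H /\ y \notin H.
Proof.
move=> SF yS; have [|||H] := coatom_avoiding rfF (X := [set y]) SF (rf_top rfF).
- by rewrite subsetT.
- by rewrite subsetT.
- by rewrite sub1set.
rewrite inE sub1set => /and4P[HF SH _ rH] yH; exists H => //.
by rewrite facet_top HF.
Qed.

(** * Facets and edges at a simple vertex *)

Section SimpleVertex.
Variable v : T.
Hypothesis simple : boolean_interval F rk [set v] setT.

Lemma simple_degree : #|nbrs v| = (rk setT).-1.
Proof.
rewrite card_nbrs (card_atoms_boolean rfF (vf_vertex vfF v) (rf_top rfF)) ?subsetT //.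
by rewrite (vf_rk1 vfF) subn1.
Qed.

Lemma simple_card_facets : #|[set H in facets F rk setT | v \in H]| = (rk setT).-1.
Proof.
rewrite -subn1 -[in RHS](vf_rk1 vfF v).
rewrite -(card_coatoms_boolean rfF (vf_vertex vfF v) (rf_top rfF)) ?subsetT //.
by congr #|pred_of_set _|; apply/setP => H; rewrite inE facet_coatom.
Qed.

Lemma simple_missed_edge H : H \in facets F rk setT -> v \in H ->
  exists w, nbrs v :\: H = [set w].
Proof.
move=> Hf vH; have HC : H \in coatoms F rk [set v] setT by rewrite -facet_coatom Hf.
have [e] := coatom_misses rfF (vf_vertex vfF v) (rf_top rfF) (subsetT _) HC.
case/adj_atomP => w vw ->; rewrite edge_sub // => wH.
exists w; apply/setP => x; rewrite !inE; apply/andP/eqP => [[xH vx]|->] //.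
apply: (@set2_inj v); apply: (simple HC); rewrite ?edge_sub //; apply/adj_atomP.
  by exists x.
by exists w.
Qed.

Lemma simple_facet_eq H K w : H \in facets F rk setT -> K \in facets F rk setT ->
  v \in H -> v \in K -> adj v w -> w \notin H -> w \notin K -> H = K.
Proof.
move=> Hf Kf vH vK vw wH wK.
apply: (coatom_eq rfF (vf_vertex vfF v) (rf_top rfF) (subsetT _) simple (a := [set v; w])).
- by rewrite -facet_coatom Hf.
- by rewrite -facet_coatom Kf.
- by apply/adj_atomP; exists w.
- by rewrite edge_sub.
- by rewrite edge_sub.
Qed.

End SimpleVertex.
End Neighbours.

(* ['I_j] indexes the apexes and ['I_k * bool] the vertices of the prism over a (k - 1)-simplex, whose
   faces are the products of a subset of ['I_k] and a subset of [bool]. *)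
Definition prism_closed (j k : nat) (M : {set 'I_j + 'I_k * bool}) : Prop :=
  forall i i' e e', inr (i, e) \in M -> inr (i', e') \in M -> inr (i, e') \in M.

Section Equality.
Variables (T : finType) (F : {set {set T}}) (rk : {set T} -> nat) (d s m : nat).
Hypothesis vfF : vertex_faces F rk.
Hypothesis rkT : rk setT = d.+1.
Hypothesis cT : #|T| = d + s.
Hypothesis hs : 1 < s <= d.
Hypothesis m0 : 0 < m.
Hypothesis md : m + 2 <= d.
Hypothesis minF :
  #|level F rk set0 setT m.+1| + 'C(d.+1 - s, m.+1) <= 'C(d.+1, m.+1) + 'C(d, m.+1).
Let rfF := vf_ranked vfF.
Implicit Types (A G H K S U : {set T}) (u v w x y : T).
Local Notation facets := (facets F rk setT).
Local Notation adj := (adj F).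
Local Notation nbrs := (nbrs F).
Local Notation meeting := (meeting F rk).

Definition big_facets := [set H in facets | 1 < #|~: H|].

Lemma big_facetP H : reflect (H \in facets /\ 1 < #|~: H|) (H \in big_facets).
Proof. exact: setIdP. Qed.

(** By [minF], every inequality used for [H] in [lower_bound] is an equality. Strict convexity then
    rules out 1 < t < s - 1, and t = 1 or t = s - 1 means that [s] or 2 vertices are missed. *)
Lemma big_facet_extremal H : H \in big_facets ->
  (#|~: H| = 2 \/ #|~: H| = s) /\
  #|meeting setT (~: H) m.+1| <= \sum_(0 <= i < #|~: H|) 'C(d - i, m).
Proof.
case/big_facetP => Hf HU; have := Hf => /facetP[HF _ rH].
have cU : #|H| + #|~: H| = #|T| by rewrite cardsC.
have cH := rk_le_card vfF HF.
case: d rkT cT hs md minF => [|d'] rkT' cT' hs' md' min'; first by nlia.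
have [t ct] : exists t, #|H| = d' + t by exists (#|H| - d'); nlia.
have tlt : 0 < t < s by nlia.
have cT2 : #|[set: T]| = d'.+1 + s by rewrite cardsT.
have [|e1 e2 e3] := facet_count vfF m (rf_top rfF) Hf rkT' cT2 ct tlt; first by nlia.
rewrite setTD in e1 e2 e3.
have := lower_bound vfF m HF _ ct; rewrite (_ : 0 < t <= d'); last by nlia.
move=> /(_ _ isT) h3; have {}h3 := h3 ltac:(nlia).
have := bin_convex (d'.+2 - s) t.-1 (s - t).-1 m.+1.
have E1 : d'.+2 - s + t.-1 + (s - t).-1 = d' by nlia.
have E2 : d'.+2 - s + (s - t).-1 = d'.+1 - t by nlia.
rewrite E1 E2 => conv; split; last by nlia.
have cU2 : #|~: H| = s - t + 1 by nlia.
have [t1|t1] := eqVneq t 1; first by right; nlia.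
have [st|st] := eqVneq (s - t) 1; first by left; nlia.
(* The side condition is m <= d' - 1, that is m + 2 <= d. *)
have := @bin_strict_convex (d'.+2 - s) t.-1 (s - t).-1 m; rewrite E1 E2 => sconv.
have {}sconv := sconv ltac:(nlia) ltac:(nlia) ltac:(nlia).
by nlia.
Qed.

(** Extending [S] to all missed vertices adds at least the remaining terms of the sum, so an excess
    at [S] would persist. *)
Lemma card_meeting_extremal H S : H \in big_facets -> S \subset ~: H ->
  #|meeting setT S m.+1| <= \sum_(0 <= i < #|S|) 'C(d - i, m).
Proof.
move=> HB SH; have [_ le] := big_facet_extremal HB.
have := @leq_card_meeting T F rk vfF setT S (~: H) m (rf_top rfF) SH (subsetT _).
rewrite rkT /= => h; have {}h := h ltac:(move: (big_facet_extremal HB).1; nlia).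
move: (leq_trans h le); rewrite [X in _ <= X](@big_cat_nat _ _ _ #|S|) //=.
  by rewrite leq_add2r.
exact: subset_leq_card.
Qed.

Lemma missed_vertex_simple H v : H \in big_facets -> v \notin H ->
  boolean_interval F rk [set v] setT.
Proof.
move=> HB vH; apply: (boolean_intervalI rfF (j := m) (vf_vertex vfF v) (rf_top rfF)).
- exact: subsetT.
- by rewrite rkT (vf_rk1 vfF); nlia.
have := @card_meeting_extremal H [set v] HB; rewrite sub1set inE cards1 big_nat1 => /(_ vH).
rewrite rkT (vf_rk1 vfF) subn0 subSS subn0; apply: leq_trans.
apply/subset_leq_card/subsetP => K; rewrite !inE => /and4P[-> vK -> /eqP->].
rewrite (vf_rk1 vfF) eqxx /=; apply/negP => /disjoint_setI0/setP/(_ v).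
by rewrite !inE -sub1set vK eqxx.
Qed.

(* If [v] and [w] were not adjacent, [w] would lie on two facets avoiding [v], whereas already one of
   them holds all the m-faces through [w] that equality allows to avoid [v]. *)
Lemma missed_vertices_adj H v w : H \in big_facets -> v \notin H -> w \notin H -> v != w ->
  adj v w.
Proof.
move=> HB vH wH vw; rewrite adj_sym; apply: contraT => nadj.
have wv : w != v by rewrite eq_sym.
have [K [Kf wK vK]] := facet_at_avoiding vfF wv.
have KC : K \in coatoms F rk [set w] setT by rewrite -facet_coatom Kf.
have KF : K \in F by case/facetP: Kf.
have rK : rk K = d by case/facetP: Kf => _ _; nlia.
pose X := [set L in F | [&& rk L == m.+1, w \in L & v \notin L]].
have sub : level F rk [set w] K m \subset X.
  apply/subsetP => L; rewrite !inE sub1set (vf_rk1 vfF) => /and4P[-> -> LK ->] /=.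
  exact: contraNN (subsetP LK v) vK.
(* At most C(d, m) + C(d - 1, m) faces of rank m + 1 meet {v, w}, and at least C(d, m) of them pass
   through [v]. *)
have leX : #|X| <= 'C(d.-1, m).
  have := @card_meeting_extremal H [set v; w] HB.
  rewrite subUset !sub1set !inE vH wH cards2 vw big_nat_recl // big_nat1 subn0 subn1 => /(_ isT).
  have := leq_card_level rfF m (vf_vertex vfF v) (rf_top rfF) (subsetT _).
  rewrite rkT (vf_rk1 vfF) subSS subn0 => h1 h2.
  rewrite -(leq_add2l 'C(d, m)); apply: leq_trans h2; apply: leq_trans (leq_add h1 (leqnn _)) _.
  rewrite -cardsUI (_ : _ :&: _ = set0) ?cards0 ?addn0.
    apply/subset_leq_card/subsetP => L; rewrite !inE subsetT sub1set (vf_rk1 vfF) /=.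
    case/orP => [/and3P[-> vL ->]|/and4P[-> -> wL _]] /=; apply/negP => /disjoint_setI0/setP.
      by move=> /(_ v); rewrite !inE vL eqxx.
    by move=> /(_ w); rewrite !inE wL eqxx orbT.
  apply/setP => L; rewrite !inE sub1set; apply/negP.
  by case/andP=> /and4P[_ vL _ _] /and4P[_ _ _]; rewrite vL.
have eX : level F rk [set w] K m = X.
  apply/eqP; rewrite eqEcard sub; apply: leq_trans leX _.
  have := leq_card_level rfF m (vf_vertex vfF w) KF; rewrite sub1set => /(_ wK).
  by rewrite rK (vf_rk1 vfF) subn1.
have [e] := coatom_misses rfF (vf_vertex vfF w) (rf_top rfF) (subsetT _) KC.
case/(adj_atomP vfF) => x wx ->; rewrite edge_sub // => xK.
have vx : v != x by apply: contraNneq nadj => ->.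
have eF : [set w; x] \in F by case/andP: wx.
have [|||L] := coatom_avoiding rfF (X := [set v]) eF (rf_top rfF).
- exact: subsetT.
- exact: subsetT.
- by rewrite sub1set !inE negb_or vw.
rewrite inE sub1set => /and4P[LF eL _ /eqP rL] vL.
(* An edge has rank 2, so m - 1 further steps reach rank m + 1. [M] contains [w] and avoids [v], yet
   contains [x] and so is not below [K]. *)
have [|M] := level_neq0 rfF (j := m.-1) eF LF eL; first by rewrite (rk_edge vfF wx); nlia.
rewrite inE (rk_edge vfF wx) => /and4P[MF eM ML /eqP rM].
have : M \in X.
  rewrite !inE MF rM (contraNN (subsetP ML v) vL) andbT /=.
  rewrite (subsetP eM) ?inE ?eqxx // andbT; apply/eqP; nlia.
rewrite -eX inE => /and4P[_ _ MK _]; case/negP: xK; apply: (subsetP MK).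
by apply: (subsetP eM); rewrite !inE eqxx orbT.
Qed.

(** A vertex outside this set is missed by a big facet, hence simple. A facet missing an apex misses
    nothing else, so the polytope is a pyramid over it. *)
Definition apexes := [set a | [forall H in big_facets, a \in H]].

Lemma apexP a : reflect (forall H, H \in big_facets -> a \in H) (a \in apexes).
Proof. by rewrite inE; apply: (iffP forall_inP). Qed.

Lemma nonapexP v : reflect (exists2 H, H \in big_facets & v \notin H) (v \notin apexes).
Proof. by rewrite inE negb_forall_in; apply: (iffP exists_inP). Qed.

Lemma apex_facet_eq a H : a \in apexes -> H \in facets -> a \notin H -> H = ~: [set a].
Proof.
move=> /apexP aA Hf aH; apply/setC_inj; rewrite setCK.
apply/esym/eqP; rewrite eqEcard sub1set inE aH cards1 leqNgt /=.
by apply: contraNN aH => HU; apply: aA; apply/big_facetP.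
Qed.

Lemma apex_facet a : a \in apexes -> ~: [set a] \in facets.
Proof.
by move=> aA; have [H Hf aH] := facet_avoiding vfF a; rewrite -(apex_facet_eq aA Hf aH).
Qed.

(** A big facet that avoids the single vertex missed by [H] would be contained in [H], hence equal
    to it. *)
Lemma small_facet H : H \in facets -> H \notin big_facets -> exists2 a, a \in apexes & H = ~: [set a].
Proof.
move=> Hf HB; have := Hf; rewrite facet_top => /andP[HF /eqP rH].
have [U0|[a aU]] := set_0Vmem (~: H).
  by move: rH; rewrite -[H]setCK U0 setC0; nlia.
have aH : a \notin H by rewrite inE in aU.
suff aA : a \in apexes by exists a => //; apply: apex_facet_eq.
apply/apexP => K KB; have /big_facetP[Kf _] := KB; apply: contraT => aK.
have HU : ~~ (1 < #|~: H|) by apply: contraNN HB => HU; apply/big_facetP.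
case/negP: HB; suff <- : K = H by [].
apply: (facet_sub_eq vfF) => //; apply/subsetP => x xK; apply: contraT => xH.
by case/negP: HU; apply/card_gt1P; exists a, x; rewrite !inE aH xH; split=> //; apply: contraNneq aK => ->.
Qed.

(** A facet through [x] avoiding [y] contains [a]: otherwise it would be the complement of [a] and
    contain [y]. *)
Lemma apex_adj a x : a \in apexes -> a != x -> adj a x.
Proof.
move=> aA ax; rewrite adjE ax /=; apply: (face_of_separation vfF) => y.
rewrite !inE negb_or => /andP[ya yx]; rewrite eq_sym in yx.
have [H [Hf xH yH]] := facet_at_avoiding vfF yx.
exists H; split=> //; first by case/facetP: Hf.
rewrite subUset !sub1set xH andbT; apply: contraNT yH => aH.
by rewrite (apex_facet_eq aA Hf aH) !inE.
Qed.

Lemma nonapex_simple v : v \notin apexes -> boolean_interval F rk [set v] setT.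
Proof. by case/nonapexP => H; apply: missed_vertex_simple. Qed.

Lemma nonapex_degree v : v \notin apexes -> #|nbrs v| = d.
Proof. by move=> /nonapex_simple/(simple_degree vfF)->; rewrite rkT. Qed.

Lemma sum_card_rel (I J : finType) (X : {set I}) (Y : {set J}) (R : I -> J -> bool) :
  \sum_(i in X) #|[set j in Y | R i j]| = \sum_(j in Y) #|[set i in X | R i j]|.
Proof.
transitivity (\sum_(i in X) \sum_(j in Y) R i j).
  by apply: eq_bigr => i _; rewrite -sum1dep_card big_mkcondr.
rewrite exchange_big; apply: eq_bigr => j _; rewrite -sum1dep_card big_mkcondr.
by apply: eq_bigr.
Qed.

Lemma apexes_sub H : H \in big_facets -> apexes \subset H.
Proof. by move=> HB; apply/subsetP => a /apexP; apply. Qed.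

Lemma nonapex_of_missed H u : H \in big_facets -> u \notin H -> u \notin apexes.
Proof. by move=> HB; apply: (contraNN (subsetP (apexes_sub HB) u)). Qed.

(** The simple vertex [u] has degree [d]. Its neighbours are all other missed vertices, all apexes,
    and some vertices of [H :\: apexes]; the extra 1 is [u] itself, counted among the missed
    vertices. *)
Lemma card_nbrs_missed H u : H \in big_facets -> u \notin H ->
  #|[set v in H :\: apexes | adj u v]| + #|~: H| + #|apexes| = d.+1.
Proof.
move=> HB uH; have uA := nonapex_of_missed HB uH.
rewrite -(nonapex_degree uA) (cardsD1 u (~: H)) inE uH add1n addnS addSn; congr _.+1.
rewrite -(cardsID H (nbrs u)) -addnA [RHS]addnC addnCA; congr (_ + _).
  congr #|pred_of_set _|; apply/setP => x; rewrite !inE andbC; case xH: (x \in H) => //=.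
  have [-> /=|xu] := eqVneq x u; first by rewrite adjE eqxx.
  by rewrite (missed_vertices_adj HB uH) ?xH // eq_sym.
rewrite -(cardsID apexes (nbrs u :&: H)) addnC; congr (_ + _); congr #|pred_of_set _|.
  apply/setP => x; rewrite 2!in_setI [in RHS]in_set.
  have [xA|] := boolP (x \in apexes); last by rewrite andbF.
  rewrite (subsetP (apexes_sub HB)) // !andbT adj_sym apex_adj //.
  by apply: contraNneq uH => <-; apply: (subsetP (apexes_sub HB)).
by apply/setP => x; rewrite in_set !in_setD in_setI [x \in nbrs u]in_set -andbA [(x \in H) && _]andbC.
Qed.

(* Every vertex of [H] outside [apexes] has exactly one neighbour missed by [H], and all vertices missed
   by [H] have equally many neighbours in [H :\: apexes]; count the edges across [H] both ways. *)
Lemma big_facet_count H : H \in big_facets ->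
  [/\ #|apexes| + s = d, #|~: H| = s -> #|H :\: apexes| = s
    & #|~: H| = s -> forall u, u \notin H -> #|[set v in H :\: apexes | adj u v]| = 1].
Proof.
move=> HB; have [r2s _] := big_facet_extremal HB; have /big_facetP[Hf r1] := HB.
have cH : #|apexes| + #|H :\: apexes| = #|H|.
  by rewrite -(cardsID apexes H) (setIidPr (apexes_sub HB)).
have cU : #|H| + #|~: H| = #|T| by rewrite cardsC.
have /card_gt0P[u0] : 0 < #|~: H| by nlia.
rewrite inE => u0H.
set k := #|[set v in H :\: apexes | adj u0 v]|.
have kE u : u \notin H -> #|[set v in H :\: apexes | adj u v]| = k.
  by move=> uH; have := card_nbrs_missed HB uH; have := card_nbrs_missed HB u0H; rewrite -/k; nlia.
have := card_nbrs_missed HB u0H; rewrite -/k => kd.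
have cB : #|H :\: apexes| = #|~: H| * k.
  have := sum_card_rel (H :\: apexes) (~: H) adj.
  rewrite (eq_bigr (fun=> 1)) => [|v]; last first.
    rewrite inE => /andP[vA vH]; have [w ew] := simple_missed_edge vfF (nonapex_simple vA) Hf vH.
    by apply/eqP/cards1P; exists w; rewrite -ew; apply/setP => x; rewrite !inE.
  rewrite sum1_card => ->; rewrite (eq_bigr (fun=> k)) => [|u]; first by rewrite sum_nat_const.
  rewrite inE => uH; rewrite -(kE u uH); congr #|pred_of_set _|.
  by apply/setP => x; rewrite !inE adj_sym.
rewrite cT in cU.
(* If [s] vertices are missed, the two counts combine to (s - 1)(k - 1) = 0. If two are missed, they
   give k = s - 1, and the number of apexes is again d - s. *)
have k1 : #|~: H| = s -> k = 1 by move=> es; rewrite es in cB kd cU; nia.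
have As : #|apexes| + s = d.
  by case: r2s => er; [rewrite er in cB kd cU|have := k1 er]; nlia.
split=> // [es|es u uH]; first by nlia.
by rewrite kE // k1.
Qed.

Lemma big_facet_ex : exists H, H \in big_facets.
Proof.
have [|H Hf] := big_facet_exists vfF (rf_top rfF); first by rewrite rkT cardsT cT; nlia.
by rewrite setTD => HU; exists H; apply/big_facetP.
Qed.

(** A simple vertex lies on [d] facets; those that are not big are the complements of the d - s
    apexes. *)
Lemma card_big_facets_at v : v \notin apexes -> #|[set H in big_facets | v \in H]| = s.
Proof.
move=> vA; have [H0 HB0] := big_facet_ex; have [As _ _] := big_facet_count HB0.
have := simple_card_facets vfF (nonapex_simple vA); rewrite rkT /=.
rewrite -(cardsID big_facets) (_ : _ :&: _ = [set H in big_facets | v \in H]); last first.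
  apply/setP => H; apply/setIP/setIdP => [[/setIdP[_ vH] HB]|[HB vH]] //; split=> //.
  by apply/setIdP; have /big_facetP[] := HB.
suff -> : [set H in facets | v \in H] :\: big_facets = [set ~: [set a] | a in apexes].
  rewrite card_imset => [h|a b /setC_inj/set1_inj //].
  by apply/eqP; rewrite -(eqn_add2r #|apexes|) h -As addnC.
apply/setP => H; apply/setDP/imsetP.
  by case=> /setIdP[Hf vH] HB; have [a aA ->] := small_facet Hf HB; exists a.
case=> a aA ->; split; last by apply/negP => /big_facetP[_]; rewrite setCK cards1.
by apply/setIdP; split; [exact: apex_facet|rewrite !inE; apply: contraNneq vA => ->].
Qed.

(* Otherwise counting incidences between big facets and non-apexes gives s ^ 2 = N (s - 1) for the
   number N of big facets, whence s = 2. *)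
Lemma extremal_facet_exists : exists2 H, H \in big_facets & #|~: H| = s.
Proof.
have [|no] := boolP [exists H in big_facets, #|~: H| == s].
  by case/exists_inP => H HB /eqP; exists H.
have two H : H \in big_facets -> #|~: H| = 2.
  move=> HB; have [[//|es] _] := big_facet_extremal HB.
  by case/negP: no; apply/exists_inP; exists H => //; apply/eqP.
have [H0 HB0] := big_facet_ex; have [As _ _] := big_facet_count HB0.
have s2 : s != 2 by apply: contraNneq no => ->; apply/exists_inP; exists H0; rewrite ?two.
have := sum_card_rel big_facets (~: apexes) (fun H v => v \in H).
rewrite (eq_bigr (fun=> 2 * s.-1)) => [|H HB]; last first.
  have := cardsC H; rewrite two // cT -(cardsID apexes H) (setIidPr (apexes_sub HB)).
  rewrite (_ : [set j in ~: apexes | j \in H] = H :\: apexes); first by nlia.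
  by apply/setP => x; rewrite in_setD in_set in_setC.
rewrite [in RHS](eq_bigr (fun=> s)) => [|v]; last by rewrite in_setC; apply: card_big_facets_at.
have := cardsC apexes; rewrite cT !sum_nat_const => cA e.
have {}e : #|big_facets| * s.-1 = s.-1 * s.+1 + 1 by nia.
have : s.-1 %| 1 by rewrite -(dvdn_addr 1 (dvdn_mulr s.+1 (dvdnn s.-1))) -e dvdn_mull.
by rewrite dvdn1; nlia.
Qed.


(** * The prism structure given by a facet that misses exactly [s] vertices *)

Section ExtremalFacet.
Variable H0 : {set T}.
Hypothesis HB0 : H0 \in big_facets.
Hypothesis cU0 : #|~: H0| = s.
Let G := H0 :\: apexes.

Let Hf0 : H0 \in facets. Proof. by case/big_facetP: HB0. Qed.

Let As : #|apexes| + s = d. Proof. by case: (big_facet_count HB0). Qed.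

Let cG : #|G| = s. Proof. by have [_ h _] := big_facet_count HB0; apply: h. Qed.

(** The lateral edges of the prism, whose bases are [G] and [~: H0]. The default is never taken for
    [g] in [G]. *)
Definition partner g := odflt g [pick w in nbrs g :\: H0].

Let GP g : reflect (g \notin apexes /\ g \in H0) (g \in G).
Proof. by rewrite in_setD; apply: andP. Qed.

Lemma partnerP g : g \in G -> nbrs g :\: H0 = [set partner g].
Proof.
case/GP=> gA gH; have [w ew] := simple_missed_edge vfF (nonapex_simple gA) Hf0 gH.
rewrite /partner; case: pickP => [x|/(_ w)]; rewrite ew ?set11 //.
by move=> /set1P->.
Qed.

Lemma partner_adj g : g \in G -> adj g (partner g) /\ partner g \notin H0.
Proof.
move=> gG; have : partner g \in nbrs g :\: H0 by rewrite partnerP // set11.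
by rewrite in_setD in_set => /andP[].
Qed.

(** A vertex missed by [H0] has only one neighbour in [G]. *)
Lemma partner_inj : {in G &, injective partner}.
Proof.
move=> g h gG hG e; have [_ _ one] := big_facet_count HB0.
have [ga gH] := partner_adj gG; have [ha _] := partner_adj hG.
have /eqP/cards1P[x ex] := one cU0 _ gH.
have : g \in [set v in H0 :\: apexes | adj (partner g) v] by rewrite in_set gG adj_sym.
have : h \in [set v in H0 :\: apexes | adj (partner g) v] by rewrite in_set hG adj_sym e.
by rewrite ex => /set1P-> /set1P->.
Qed.

Lemma partner_imset : partner @: G = ~: H0.
Proof.
apply/eqP; rewrite eqEcard (card_in_imset partner_inj) cG cU0 leqnn andbT.
by apply/subsetP => x /imsetP[g gG ->]; rewrite in_setC; case: (partner_adj gG).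
Qed.

(** Of the [d] neighbours of [g], one lies outside [H0] and at most d - s are apexes; the remaining
    s - 1 or more must fill [G :\ g]. *)
Lemma base_clique g h : g \in G -> h \in G -> g != h -> adj g h.
Proof.
move=> gG hG gh; have /GP[gA gH] := gG.
have sub : nbrs g :&: G \subset G :\ g.
  apply/subsetP => x /setIP[]; rewrite in_set => gx xG; rewrite in_setD1 xG andbT.
  by apply: contraTneq gx => ->; rewrite adjE eqxx.
suff /eqP e : nbrs g :&: G == G :\ g.
  have : h \in G :\ g by rewrite in_setD1 eq_sym gh.
  by rewrite -e in_setI in_set => /andP[].
rewrite eqEcard sub; have := cardsD1 g G; rewrite gG cG => cGg.
have := nonapex_degree gA; rewrite -(cardsID H0 (nbrs g)) partnerP // cards1.
rewrite -(cardsID apexes (nbrs g :&: H0)) => deg.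
have : #|(nbrs g :&: H0) :&: apexes| <= #|apexes| by apply: subset_leq_card; apply: subsetIr.
have : (nbrs g :&: H0) :\: apexes = nbrs g :&: G by rewrite /G setIDA.
by move: deg => /[swap] -> deg le; nlia.
Qed.

Lemma partner_base : forall g, g \in G -> partner g \notin G.
Proof. by move=> g gG; apply/negP => /GP[_]; apply/negP; case: (partner_adj gG). Qed.

Lemma notin_facetP H x : H \in big_facets -> x \notin H ->
  x \in G \/ exists2 g, g \in G & x = partner g.
Proof.
move=> HB xH; have xA := nonapex_of_missed HB xH.
have [xH0|xH0] := boolP (x \in H0); first by left; apply/GP.
have : x \in ~: H0 by rewrite in_setC.
by rewrite -partner_imset => /imsetP; right.
Qed.

(** If [x] in [G] lies on [H], so does its partner: otherwise [H] and [H0] would be two facets at a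
    simple vertex missing the same neighbour. The one neighbour [h] of [g] missed by [H] is
    therefore in [G]; as [G] is a clique, the rest of [G] lies on [H], together with the
    partners. *)
Lemma big_facet_meeting_base H g : H \in big_facets -> H != H0 -> g \in G -> g \in H ->
  exists2 h, h \in G & ~: H = [set h; partner h].
Proof.
move=> HB HH0 gG gH; have /big_facetP[Hf HU] := HB.
have pH x : x \in G -> x \in H -> partner x \in H.
  move=> xG xH; have [xa xn] := partner_adj xG; have /GP[xA xH0] := xG.
  apply: contraNT HH0 => px; apply/eqP.
  exact: (simple_facet_eq vfF (nonapex_simple xA) Hf Hf0 xH xH0 xa).
have /GP[gA gH0] := gG.
have [h eh] := simple_missed_edge vfF (nonapex_simple gA) Hf gH.
have : h \in nbrs g :\: H by rewrite eh set11.
rewrite in_setD in_set => /andP[hH gh].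
have hG : h \in G.
  have [//|[x xG ex]] := notin_facetP HB hH.
  have hH0 : h \notin H0 by rewrite ex; case: (partner_adj xG).
  have : h \in nbrs g :\: H0 by rewrite in_setD hH0 in_set.
  by rewrite partnerP // => /set1P e; rewrite e (pH g) in hH.
have inH x : x \in G -> x != h -> x \in H.
  move=> xG xh; have [<- //|gx] := eqVneq g x.
  apply: contraT => xH; have : x \in nbrs g :\: H.
    by rewrite in_setD xH in_set base_clique.
  by rewrite eh in_set1 (negPf xh).
exists h => //; apply/eqP; rewrite eqEcard; apply/andP; split; last first.
  by apply: leq_trans HU; rewrite cards2 ltnS leq_b1.
apply/subsetP => x; rewrite in_setC => xH; rewrite !inE.
have [xG|[y yG ex]] := notin_facetP HB xH.
  by rewrite orbC; apply/orP; right; apply: contraNT xH; apply: inH.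
apply/orP; right; rewrite ex; have [-> //|yh] := eqVneq y h.
by rewrite ex (pH y) ?inH in xH.
Qed.

(** [H] is not inside [H0], so it contains some partner [u] of a vertex [g] of [G]. At the simple
    vertex [u] it misses the neighbour [g] and no other, hence it contains all of the clique
    [~: H0]. *)
Lemma big_facet_avoiding_base H : H \in big_facets -> (forall g, g \in G -> g \notin H) ->
  H = apexes :|: ~: H0.
Proof.
move=> HB noG; have /big_facetP[Hf HU] := HB.
have AH := apexes_sub HB.
have sub : H \subset apexes :|: ~: H0.
  apply/subsetP => x xH; rewrite in_setU in_setC orbC -implybE; apply/implyP => xH0.
  by apply: contraTT xH => xA; apply: noG; apply/GP.
apply/eqP; rewrite eqEsubset sub subUset AH /=.
have [/pred0P no|/pred0Pn[u /andP[/= uH uU]]] := boolP [disjoint H & ~: H0].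
  have HH0 : H \subset H0.
    by apply/subsetP => x xH; have := no x; rewrite /= xH in_setC => /negbFE.
  have /card_gt0P[g gG] : 0 < #|G| by rewrite cG; nlia.
  have e := facet_sub_eq vfF Hf Hf0 HH0.
  by have := noG g gG; rewrite e; have /GP[_ ->] := gG.
have uH0 : u \notin H0 by rewrite in_setC in uU.
move: uU; rewrite -partner_imset => /imsetP[g gG ug].
have uA := nonapex_of_missed HB0 uH0.
have [h eh] := simple_missed_edge vfF (nonapex_simple uA) Hf uH.
have : g \in nbrs u :\: H.
  by rewrite in_setD noG // in_set adj_sym ug; case: (partner_adj gG).
rewrite eh => /set1P hg; apply/subsetP => x; rewrite partner_imset in_setC => xH0.
have [-> //|xu] := eqVneq x u.
apply: contraT => xH; have : x \in nbrs u :\: H.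
  by rewrite in_setD xH in_set (missed_vertices_adj HB0) // eq_sym.
by rewrite eh -hg => /set1P e; move: xH0; rewrite e; have /GP[_ ->] := gG.
Qed.

Lemma facet_big H g : H \in facets -> g \in G -> g \notin H -> H \in big_facets.
Proof.
move=> Hf gG gH; apply: contraT => /(small_facet Hf)[a aA eH].
by move: gH; rewrite eH !inE negbK => /eqP e; have /GP[] := gG; rewrite e aA.
Qed.

(** Take a facet through [partner g] that avoids [g]. If it met [G], it would miss a whole pair of
    partners containing [g], and so [partner g] too. *)
Lemma opposite_facet : apexes :|: ~: H0 \in facets.
Proof.
have /card_gt0P[g gG] : 0 < #|G| by rewrite cG; nlia.
have [ga gH0] := partner_adj gG.
have pg : partner g != g by apply: contraNneq gH0 => ->; have /GP[] := gG.
have [H [Hf pH gH]] := facet_at_avoiding vfF pg.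
have HB := facet_big Hf gG gH.
rewrite -(big_facet_avoiding_base HB) // => x xG; apply/negP => xH.
have HH0 : H != H0 by apply: contraNneq gH0 => <-.
have [h hG eh] := big_facet_meeting_base HB HH0 xG xH.
have : g \in ~: H by rewrite in_setC.
rewrite eh => /set2P[e|e]; last by have := partner_base hG; rewrite -e gG.
have : partner g \in ~: H by rewrite eh e !inE eqxx orbT.
by rewrite in_setC pH.
Qed.

Lemma lateral_facet h : h \in G -> ~: [set h; partner h] \in facets.
Proof.
move=> hG; have : 1 < #|G| by rewrite cG; case/andP: hs.
case/card_gt1P => x [y [xG yG xy]].
have [g gG gh] : exists2 g, g \in G & g != h.
  by have [xh|xh] := eqVneq x h; [exists y => //; rewrite -xh eq_sym|exists x].
have [H [Hf gH hH]] := facet_at_avoiding vfF gh.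
have HB := facet_big Hf hG hH.
have HH0 : H != H0 by apply: contraNneq hH => ->; have /GP[] := hG.
have [h' hG' eh] := big_facet_meeting_base HB HH0 gG gH.
have : h \in ~: H by rewrite in_setC.
rewrite eh => /set2P[e|e]; first by rewrite e -eh setCK.
by have := partner_base hG'; rewrite -e hG.
Qed.

Lemma facet_cases H : H \in facets ->
  [\/ exists2 a, a \in apexes & H = ~: [set a], H = H0, H = apexes :|: ~: H0
    | exists2 h, h \in G & H = ~: [set h; partner h]].
Proof.
move=> Hf; have [HB|/(small_facet Hf)] := boolP (H \in big_facets); last by constructor 1.
have [->|HH0] := eqVneq H H0; first by constructor 2.
have [/exists_inP[g gG gH]|no] := boolP [exists g in G, g \in H].
  have [h hG eh] := big_facet_meeting_base HB HH0 gG gH.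
  by constructor 4; exists h => //; rewrite -eh setCK.
constructor 3; apply: big_facet_avoiding_base HB _ => g gG; apply: contraNN no => gH.
by apply/exists_inP; exists g.
Qed.

Lemma triplex_structure_at : exists psi : 'I_(d - s) + 'I_s * bool -> T,
  bijective psi /\ forall S, S \in F <-> prism_closed (psi @^-1: S).
Proof.
have cA : #|apexes| = d - s by nlia.
pose f (z : 'I_(d - s) + 'I_s * bool) : T := match z with
  | inl i => enum_val (cast_ord (esym cA) i)
  | inr (i, e) => let g := enum_val (cast_ord (esym cG) i) in if e then partner g else g
  end.
have fA i : f (inl i) \in apexes by apply: enum_valP.
have fG i : f (inr (i, false)) \in G by apply: enum_valP.
have fp i : f (inr (i, true)) = partner (f (inr (i, false))) by [].
have fH0 i e : (f (inr (i, e)) \in H0) = ~~ e.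
  case: e; last by have /GP[] := fG i.
  by rewrite fp; apply/negbTE; case: (partner_adj (fG i)).
have fnA i e : f (inr (i, e)) \notin apexes.
  case: e; last by have /GP[] := fG i.
  by apply: (nonapex_of_missed HB0); rewrite fH0.
have fGinj i i' e : f (inr (i, e)) = f (inr (i', e)) -> i = i'.
  move=> h; have {}h : f (inr (i, false)) = f (inr (i', false)).
    by case: e h => // /(partner_inj (fG i) (fG i')).
  by move: h => /enum_val_inj /cast_ord_inj.
have finj : injective f.
  move=> [i|[i e]] [i'|[i' e']] h.
  - by move: h => /enum_val_inj /cast_ord_inj ->.
  - by have := fnA i' e'; rewrite -h fA.
  - by have := fnA i e; rewrite h fA.
  - have ee : e = e' by apply: negb_inj; rewrite -(fH0 i) h fH0.
    by subst e'; rewrite (fGinj _ _ _ h).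
have fbij : bijective f.
  apply: inj_card_bij finj _; rewrite card_sum card_prod !card_ord card_bool cT; nlia.
exists f; split=> // S.
have Ginv g : g \in G -> exists i, g = f (inr (i, false)).
  move=> gG; exists (cast_ord cG (enum_rank_in gG g)).
  by rewrite /f cast_ordK enum_rankK_in.
have fE i e i' e' : (f (inr (i, e)) == f (inr (i', e'))) = (i == i') && (e == e').
  by rewrite (inj_eq finj).
have lat h i e : h \in G -> (f (inr (i, e)) \in ~: [set h; partner h]) = (f (inr (i, false)) != h).
  move=> /Ginv[i' ->]; rewrite -fp !inE negb_or !fE.
  by case: e; case: (i == i').
split=> [SF|clS].
  (* A face is cut out by facets, so the closure property is checked on each of the four kinds of
     facet. *)
  move=> i i' e e'; rewrite !in_set => ie ie'; apply: contraT => no.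
  have [H Hf [SH nH]] := facet_containing vfF SF no.
  have := subsetP SH _ ie; have := subsetP SH _ ie'; move: nH.
  case: (facet_cases Hf) => [[a aA ->]|->|->|[h hG ->]].
  - by rewrite !inE negbK => /eqP e1; have := fnA i e'; rewrite e1 aA.
  - by rewrite !fH0 => /negPf->.
  - by rewrite !in_setU !in_setC !fH0 !(negPf (fnA _ _)) => /negPf->.
  - by rewrite !lat // => /negPf->.
apply: (face_of_separation vfF) => y yS; have [f' fK f'K] := fbij.
have facetF H : H \in facets -> H \in F by case/facetP.
have ey := f'K y; case ez: (f' y) ey => [i|[i e]] ey.
  exists (~: [set y]); rewrite -ey; split; first by apply: facetF; apply: apex_facet.
    by apply/subsetP => x xS; rewrite !inE; apply: contraNneq yS => e; rewrite -ey -e.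
  by rewrite !inE eqxx.
have S_sub H : (forall z, f z \in S -> f z \in H) -> S \subset H.
  by move=> h; apply/subsetP => x; rewrite -(f'K x); apply: h.
(* When the partner of [y] is also outside [S], the lateral facet missing both separates. Otherwise
   closure keeps [S] off the base containing [y], and the facet spanned by the apexes and the other
   base separates. *)
have [oS|oS] := boolP (f (inr (i, ~~ e)) \in S); last first.
  exists (~: [set f (inr (i, false)); f (inr (i, true))]); rewrite fp; split.
  - exact/facetF/lateral_facet.
  - apply: S_sub => -[a|[i' e']] zS.
      rewrite !inE negb_or -fp; apply/andP; split; apply: contraTneq (fA a) => ->; exact: fnA.
    rewrite lat //; apply: contraNneq yS => /fGinj ei; subst i'.
    rewrite -ey; have [-> //|ne] := eqVneq e e'.
    have ee : ~~ e = e' by move: ne; case: (e); case: (e').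
    by rewrite ee zS in oS.
  - by rewrite -ey lat // eqxx.
have noS i' : f (inr (i', e)) \notin S.
  apply: contraNN yS => h; rewrite -ey; have := clS i i' (~~ e) e.
  by rewrite !in_set; apply.
case: e ey oS noS {ez} => ey oS noS.
  exists H0; split; [exact: facetF| |by rewrite -ey fH0].
  apply: S_sub => -[a|[i' e']] zS; first by apply: (subsetP (apexes_sub HB0)).
  by rewrite fH0; apply: contraTN zS => ->.
exists (apexes :|: ~: H0); split; first exact/facetF/opposite_facet.
  apply: S_sub => -[a|[i' e']] zS; first by rewrite in_setU fA.
  by rewrite in_setU in_setC fH0 negbK orbC; case: e' zS => // zS; have := noS i'; rewrite zS.
by rewrite -ey in_setU in_setC fH0 (negPf (fnA _ _)).
Qed.

End ExtremalFacet.

Theorem extremal_triplex : exists psi : 'I_(d - s) + 'I_s * bool -> T,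
  bijective psi /\ forall S, S \in F <-> prism_closed (psi @^-1: S).
Proof. by have [H HB cH] := extremal_facet_exists; apply: triplex_structure_at HB cH. Qed.

End Equality.

(** * The number of faces of a triplex *)

(** For k = 1 the closure condition is vacuous, so any bijection serves and every set must be a
    face. A facet has at least [d] of the d + 1 vertices, hence is the complement of the vertex it
    avoids. *)
Lemma simplex_triplex (T : finType) (F : {set {set T}}) (rk : {set T} -> nat) (d : nat) :
  vertex_faces F rk -> rk setT = d.+1 -> #|T| = d + 1 -> 0 < d ->
  exists psi : 'I_(d - 1) + 'I_1 * bool -> T,
  bijective psi /\ forall S, S \in F <-> prism_closed (psi @^-1: S).
Proof.
move=> vfF rkT cT d0.
have cZ : #|{: 'I_(d - 1) + 'I_1 * bool}| = #|T|.
  by rewrite card_sum card_prod !card_ord card_bool cT; nlia.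
exists (fun z => enum_val (cast_ord cZ (enum_rank z))); split.
  exists (fun x => enum_val (cast_ord (esym cZ) (enum_rank x))) => z.
    by rewrite enum_valK cast_ordK enum_rankK.
  by rewrite enum_valK cast_ordKV enum_rankK.
move=> S; split=> [_ i i' e e'|_]; first by rewrite (ord1 i) (ord1 i').
apply: (face_of_separation vfF) => y yS; have [H Hf yH] := facet_avoiding vfF y.
have /facetP[HF _ rH] := Hf; exists H; split=> //.
suff -> : H = ~: [set y] by apply/subsetP => x xS; rewrite !inE; apply: contraNneq yS => <-.
apply/eqP; rewrite eqEcard; apply/andP; split.
  by apply/subsetP => x xH; rewrite !inE; apply: contraNneq yH => <-.
by have := rk_le_card vfF HF; have := cardsC [set y]; rewrite cards1; nlia.
Qed.

(** * Transport of a face family along a bijection of the vertices *)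

Section Transport.
Variables (T T' : finType) (psi : T' -> T).
Hypothesis psi_bij : bijective psi.

Let inj : injective psi := bij_inj psi_bij.

Lemma imset_sub_inj (A B : {set T'}) : (psi @: A \subset psi @: B) = (A \subset B).
Proof.
apply/idP/idP => [/subsetP sub|]; last exact: imsetS.
by apply/subsetP => x xA; have := sub _ (imset_f psi xA); rewrite mem_imset.
Qed.

Lemma imset_proper_inj (A B : {set T'}) : (psi @: A \proper psi @: B) = (A \proper B).
Proof. by rewrite !properE !imset_sub_inj. Qed.

Lemma imset_preimset (K : {set T}) : psi @: (psi @^-1: K) = K.
Proof.
have [f fK Kf] := psi_bij; apply/setP => x; rewrite -(Kf x) mem_imset //.
by rewrite inE.
Qed.

Lemma vertex_faces_imset F rk : vertex_faces F rk ->
  vertex_faces [set M : {set T'} | psi @: M \in F] (fun M => rk (psi @: M)).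
Proof.
case=> -[top meet mono gap] bot rk0 vert rk1 edge.
split; rewrite ?inE ?imset0 //.
- split=> [|A B|A B|A B].
  + rewrite inE (_ : _ @: _ = setT) //; apply/setP => x; have [f fK Kf] := psi_bij.
    by rewrite -(Kf x) mem_imset // !inE.
  + by rewrite !inE => AF BF; rewrite imsetI ?meet // => x y _ _; apply: inj.
  + by rewrite !inE -imset_proper_inj; apply: mono.
  rewrite !inE -imset_proper_inj => AF BF AB /(gap _ _ AF BF AB)[K [L]].
  rewrite -(imset_preimset K) -(imset_preimset L) !imset_proper_inj.
  case=> KF LF [AK AL] [KB LB] e.
  exists (psi @^-1: K), (psi @^-1: L); rewrite !inE; split=> //.
  by apply: (imset_inj inj); rewrite imsetI // => x y _ _; apply: inj.
- by move=> x; rewrite inE imset_set1.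
- by move=> x; rewrite imset_set1.
by move=> A; rewrite inE => AF /(edge _ AF); rewrite card_imset.
Qed.

Lemma card_level_imset F rk j : #|level F rk set0 setT j| =
  #|level [set M : {set T'} | psi @: M \in F] (fun M => rk (psi @: M)) set0 setT j|.
Proof.
rewrite -[RHS](card_imset _ (imset_inj inj)); congr #|pred_of_set _|; apply/setP => K.
rewrite -(imset_preimset K) mem_imset ?inE; last exact: imset_inj.
by rewrite !sub0set !subsetT imset0.
Qed.
End Transport.

Section TriplexCount.
Variables (j k : nat).
Local Notation Z := ('I_j + 'I_k * bool)%type.
Variables (F : {set {set Z}}) (rk : {set Z} -> nat).
Hypothesis vfF : vertex_faces F rk.
Hypothesis FP : forall M, M \in F <-> prism_closed M.
Let rfF := vf_ranked vfF.
Implicit Types (M K L : {set Z}).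

(** The apexes together with one base of the prism. They span a simplex: every subset is a face,
    ranked by its cardinality. *)
Definition base (b : bool) : {set Z} :=
  [set z | if z is inr (_, e) then e == b else true].

Lemma card_base b : #|base b| = j + k.
Proof.
pose f (x : 'I_j + 'I_k) : Z := match x with inl a => inl a | inr i => inr (i, b) end.
have finj : injective f by move=> [a|i] [a'|i'] // [->].
rewrite -[RHS](_ : #|{: 'I_j + 'I_k}| = j + k); last by rewrite card_sum !card_ord.
rewrite -cardsT -(card_imset _ finj); congr #|pred_of_set _|; apply/setP => -[a|[i e]].
  by rewrite inE; apply/esym/imsetP; exists (inl a).
rewrite inE; apply/eqP/imsetP => [->|[[a|i'] _ //= [_ ->]]] //.
by exists (inr i).
Qed.

Lemma card_axis : #|base false :&: base true| = j.
Proof.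
have finj : injective (inl : 'I_j -> Z) by move=> a a' [].
rewrite -[RHS]card_ord -cardsT -(card_imset _ finj); congr #|pred_of_set _|.
apply/setP => -[a|[i e]]; rewrite !inE; first by apply/esym/imsetP; exists a.
by apply/andP/imsetP => [[/eqP->]|[]].
Qed.

Lemma sub_base_closed M b : M \subset base b -> M \in F.
Proof.
move=> /subsetP sub; apply/FP => i i' e e' ie ie'.
by have := sub _ ie; have := sub _ ie'; rewrite !inE => /eqP-> /eqP <-.
Qed.

Lemma rk_sub_base M b : M \subset base b -> rk M = #|M|.
Proof.
move=> Mb; apply/eqP; rewrite eqn_leq (rk_le_card vfF) ?(sub_base_closed Mb) //=.
move: {2}#|M| (erefl #|M|) => n; elim: n M Mb => [|n IH] M Mb cM; first by rewrite cM.
have /set0Pn[x xM] : M != set0 by rewrite -cards_eq0 cM.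
have Mb' : M :\ x \subset base b by apply: subset_trans (subsetDl _ _) Mb.
have := rf_mono rfF (sub_base_closed Mb') (sub_base_closed Mb) (properD1 xM).
have e : #|M :\ x| = n by have := cardsD1 x M; rewrite xM cM => -[].
by have := IH _ Mb' e; rewrite e cM; apply: leq_ltn_trans.
Qed.

Lemma not_sub_baseP M b : reflect (exists i, inr (i, ~~ b) \in M) (~~ (M \subset base b)).
Proof.
apply: (iffP subsetPn) => [[z zM]|[i iM]]; last first.
  by exists (inr (i, ~~ b)) => //; rewrite inE; case: (b).
rewrite inE; case: z zM => [//|[i e]] iM eb; exists i.
by rewrite (_ : ~~ b = e) //; case: e b eb {iM} => -[].
Qed.

(** No face lies strictly between the trace of [M] on [base false] and [M]: it would contain some
    [(i, true)], and closure would then add every other vertex of [M] on that side. *)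
Lemma rk_lateral M : M \in F -> ~~ (M \subset base false) -> ~~ (M \subset base true) ->
  rk M = #|M :&: base false|.+1.
Proof.
move=> MF nf nt; set L := M :&: base false.
have LF : L \in F by apply: (@sub_base_closed _ false); apply: subsetIr.
have LM : L \proper M by rewrite properEneq subsetIl andbT; apply: contraNneq nf => /setIidPl.
rewrite -(@rk_sub_base _ false (subsetIr _ _)) -/L; apply/eqP.
rewrite eqn_leq (rf_mono rfF) // andbT leqNgt; apply/negP => gt.
have [|K [_ [KF _ [LK _] [KM _] _]]] := rf_gap rfF LF MF LM; first by rewrite addn2.
have /properP[_ [[a|[i e]] zK zL]] := LK.
  by move: zL; rewrite !inE (subsetP (proper_sub KM)).
have et : e = true.
  by move: zL; rewrite !inE (subsetP (proper_sub KM)) //=; case: (e).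
subst e; have [i0 i0M] := not_sub_baseP _ _ nt.
have /properP[_ [z zM /negP[]]] := KM.
have inK y : y \in M -> y \in base false -> y \in K.
  by move=> yM yb; apply: (subsetP (proper_sub LK)); rewrite inE yM.
case: z zM => [a|[i' e]] zM; first by apply: inK; rewrite ?inE.
have i'K : inr (i', false) \in K.
  by apply: inK; rewrite ?inE //; move/FP: MF => MF; apply: MF zM i0M.
by case: e zM => zM //; move/FP: KF => KF; apply: KF i'K zK.
Qed.

Lemma card_draws_diff n (A B : {set Z}) : B \subset A ->
  #|[set M : {set Z} | [&& M \subset A, ~~ (M \subset B) & #|M| == n]]| + 'C(#|B|, n) = 'C(#|A|, n).
Proof.
move=> BA; rewrite -!cards_draws addnC -cardsUI (_ : _ :&: _ = set0) ?cards0 ?addn0.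
  congr #|pred_of_set _|; apply/setP => M; rewrite !inE.
  have [MB|_] /= := boolP (M \subset B); rewrite ?andbF ?orbF ?orFb //.
  by rewrite (subset_trans MB).
by apply/setP => M; rewrite !inE; case: (M \subset B); rewrite ?andbF.
Qed.

(* The faces meeting both bases are determined by their trace on [base false]. *)
Definition lateral L : {set Z} :=
  [set z | match z with inr (i, e) => inr (i, false) \in L | z => z \in L end].

Lemma lateral_closed L : lateral L \in F.
Proof. by apply/FP => i i' e e'; rewrite !inE. Qed.

Lemma lateralK L : L \subset base false -> lateral L :&: base false = L.
Proof.
move=> /subsetP sub; apply/setP => -[a|[i e]]; rewrite !inE ?andbT //=.
case: e => /=; rewrite ?andbT ?andbF //.
by apply/esym/negP => /sub; rewrite inE.
Qed.

Lemma lateral_base M : M \in F -> ~~ (M \subset base false) -> ~~ (M \subset base true) ->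
  lateral (M :&: base false) = M.
Proof.
move=> /FP MF /not_sub_baseP[i iM] /not_sub_baseP[i' iM'].
apply/setP => -[a|[l e]]; rewrite !inE ?andbT //=; apply/idP/idP => lM.
  by case: e => //; apply: MF lM iM.
exact: MF lM iM'.
Qed.

(** [X1] holds the faces in one base, [X2] those in the other base but not made of apexes only, and
    [X3] the traces of the faces meeting both prism bases. A trace has [m] elements because it lies
    one rank below its face. *)
Lemma card_level_triplex m :
  #|level F rk set0 setT m.+1| + 'C(j.+1, m.+1) = 'C((j + k).+1, m.+1) + 'C(j + k, m.+1).
Proof.
pose X1 := [set M : {set Z} | M \subset base false & #|M| == m.+1].
pose X2 := [set M : {set Z} | [&& M \subset base true, ~~ (M \subset base false :&: base true) & #|M| == m.+1]].
pose X3 := [set M : {set Z} | [&& M \subset base false, ~~ (M \subset base false :&: base true) & #|M| == m]].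
have cX1 : #|X1| = 'C(j + k, m.+1) by rewrite cards_draws card_base.
have cX2 : #|X2| + 'C(j, m.+1) = 'C(j + k, m.+1).
  by have := card_draws_diff m.+1 (subsetIr (base false) (base true)); rewrite card_base card_axis.
have cX3 : #|X3| + 'C(j, m) = 'C(j + k, m).
  by have := card_draws_diff m (subsetIl (base false) (base true)); rewrite card_base card_axis.
have latI : {in X3 &, injective lateral}.
  move=> L L'; rewrite !inE => /andP[Lb _] /andP[Lb' _] e.
  by rewrite -(lateralK Lb) e lateralK.
suff -> : level F rk set0 setT m.+1 = X1 :|: X2 :|: lateral @: X3.
  have d12 : [disjoint X1 & X2].
    rewrite disjoints_subset; apply/subsetP => M; rewrite !inE => /andP[Mb ->].
    by rewrite andbT subsetI Mb /= andbN.
  have d3 : [disjoint X1 :|: X2 & lateral @: X3].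
    rewrite disjoints_subset; apply/subsetP => M MX; rewrite inE; apply/negP => /imsetP[L].
    rewrite inE subsetI => /and3P[Lb]; rewrite Lb /= => /not_sub_baseP[i iL] _ eM.
    have n0 : ~~ (M \subset base false) by apply/not_sub_baseP; exists i; rewrite eM inE.
    have n1 : ~~ (M \subset base true) by apply/not_sub_baseP; exists i; rewrite eM inE.
    by move: MX; rewrite !inE (negPf n0) (negPf n1).
  move: d12 d3; rewrite -!leq_card_setU => /eqP e12 /eqP e3.
  rewrite e3 e12 (card_in_imset latI) !binS; nlia.
apply/setP => M; rewrite !inE sub0set subsetT (vf_rk0 vfF) add0n /=.
have [Mb|nb] /= := boolP (M \subset base false).
  rewrite (sub_base_closed Mb) (rk_sub_base Mb) subsetI Mb /= andbA andbN /= orbF.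
  case: (_ == _) => //=; apply/esym/negP => /imsetP[L].
  rewrite inE subsetI => /and3P[Lb]; rewrite Lb /= => /not_sub_baseP[i iL] _ eM.
  have /subsetP/(_ (inr (i, true))) := Mb.
  by rewrite eM !inE => /(_ iL).
rewrite subsetI (negPf nb) /=.
have [Mb|nb'] /= := boolP (M \subset base true).
  rewrite (sub_base_closed Mb) (rk_sub_base Mb) /=.
  case: (_ == _) => //=; apply/esym/negP => /imsetP[L].
  rewrite inE subsetI => /and3P[Lb]; rewrite Lb /= => /not_sub_baseP[i iL] _ eM.
  have /subsetP/(_ (inr (i, false))) := Mb.
  by rewrite eM !inE => /(_ iL).
apply/andP/imsetP => [[MF]|[L]].
  rewrite (rk_lateral MF nb nb') eqSS => /eqP cM; exists (M :&: base false).
    rewrite inE subsetIr cM eqxx andbT /= subsetI subsetIr /=.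
    have /not_sub_baseP[i iM] := nb'; apply/not_sub_baseP; exists i.
    by rewrite !inE iM.
  by rewrite lateral_base.
rewrite inE => /and3P[Lb _ /eqP cL] eM; have MF : M \in F by rewrite eM lateral_closed.
by split=> //; rewrite (rk_lateral MF nb nb') eM lateralK // cL.
Qed.

End TriplexCount.

Theorem card_level_of_triplex (T : finType) (F : {set {set T}}) (rk : {set T} -> nat)
  (j k m : nat) (psi : 'I_j + 'I_k * bool -> T) :
  vertex_faces F rk -> bijective psi ->
  (forall S, S \in F <-> prism_closed (psi @^-1: S)) ->
  #|level F rk set0 setT m.+1| + 'C(j.+1, m.+1) = 'C((j + k).+1, m.+1) + 'C(j + k, m.+1).
Proof.
move=> vfF psiB FP; rewrite (card_level_imset psiB).
apply: card_level_triplex; first exact: vertex_faces_imset.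
move=> M; rewrite inE FP (_ : _ @^-1: _ = M) //.
by apply: (imset_inj (bij_inj psiB)); rewrite imset_preimset.
Qed.

(** * Isomorphisms of face lattices *)

Definition order_iso (T T' : finType) (F : {set {set T}}) (F' : {set {set T'}})
    (phi : {set T} -> {set T'}) : Prop :=
  [/\ forall A, A \in F -> phi A \in F',
      forall B, B \in F' -> exists2 A, A \in F & phi A = B
    & forall A B, A \in F -> B \in F -> (phi A \subset phi B) = (A \subset B)].

Lemma order_iso_comp (T1 T2 T3 : finType) (F1 : {set {set T1}}) (F2 : {set {set T2}})
    (F3 : {set {set T3}}) phi psi :
  order_iso F1 F2 phi -> order_iso F2 F3 psi -> order_iso F1 F3 (psi \o phi).
Proof.
move=> [h1 h2 h3] [g1 g2 g3]; split=> [A AF|B /g2[A AF <-]|A B AF BF] /=.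
- exact/g1/h1.
- by have [C CF <-] := h2 A AF; exists C.
- by rewrite g3 ?h1 // h3.
Qed.

Lemma order_iso_sym (T T' : finType) (F : {set {set T}}) (F' : {set {set T'}}) phi :
  order_iso F F' phi -> exists psi, order_iso F' F psi.
Proof.
move=> [h1 h2 h3]; pose psi B := odflt set0 [pick A in F | phi A == B].
have psiP B : B \in F' -> psi B \in F /\ phi (psi B) = B.
  move=> BF; rewrite /psi; case: pickP => [A /andP[AF /eqP]|no] //.
  by have [A AF e] := h2 B BF; have := no A; rewrite AF e eqxx.
exists psi; split=> [B /psiP[]|A AF|A B AF BF] //.
  have [pF pE] := psiP _ (h1 A AF); exists (phi A); first exact: h1.
  by apply/eqP; rewrite eqEsubset -!h3 // pE subxx.
by have [aF aE] := psiP A AF; have [bF bE] := psiP B BF; rewrite -h3 // aE bE.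
Qed.

(** If [phi A] is the singleton of [y], any [x] in [A] has a nonempty image inside it, so [phi]
    matches singletons with singletons and is the preimage under the resulting map [psi]. *)
Lemma order_iso_vertices (T T' : finType) (F : {set {set T}}) (F' : {set {set T'}}) phi :
  set0 \in F -> (forall x, [set x] \in F) -> set0 \in F' -> (forall y, [set y] \in F') ->
  order_iso F F' phi ->
  exists psi : T' -> T, bijective psi /\ forall S, (S \in F) = (psi @^-1: S \in F').
Proof.
move=> F0 F1 F0' F1' [h1 h2 h3].
have phi_inj A B : A \in F -> B \in F -> phi A = phi B -> A = B.
  by move=> AF BF e; apply/eqP; rewrite eqEsubset -!h3 // e subxx.
have phi0 : phi set0 = set0.
  have [A AF eA] := h2 _ F0'; apply/eqP; rewrite -subset0 -eA h3 //; exact: sub0set.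
have phi_neq0 A : A \in F -> A != set0 -> phi A != set0.
  by move=> AF; apply: contra_neq => e; apply: phi_inj; rewrite // phi0.
have vert y : exists x, phi [set x] == [set y].
  have [A AF eA] := h2 _ (F1' y).
  have /set0Pn[x xA] : A != set0.
    by apply/eqP => e; move/setP/(_ y): eA; rewrite e phi0 !inE eqxx.
  exists x; have : phi [set x] \subset [set y] by rewrite -eA h3 // sub1set.
  rewrite subset1 => /orP[//|]; rewrite (negPf (phi_neq0 _ _ _)) //.
  by apply/set0Pn; exists x; rewrite inE.
pose psi y := xchoose (vert y).
have psiP y : phi [set psi y] = [set y] := eqP (xchooseP (vert y)).
have psi_inj : injective psi.
  by move=> y y' e; apply: set1_inj; rewrite -!psiP e.
have phiE A : A \in F -> phi A = psi @^-1: A.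
  by move=> AF; apply/setP => y; rewrite inE -!sub1set -h3 // psiP.
have psi_surj x : exists y, psi y == x.
  have /set0Pn[y] : phi [set x] != set0.
    by apply: phi_neq0 => //; apply/set0Pn; exists x; rewrite inE.
  by rewrite phiE // !inE; exists y.
exists psi; split.
  exists (fun x => xchoose (psi_surj x)) => x; last exact/eqP/(xchooseP (psi_surj x)).
  by apply: psi_inj; apply/eqP/(xchooseP (psi_surj (psi x))).
move=> S; apply/idP/idP => [SF|/h2[A AF]]; first by rewrite -phiE // h1.
rewrite phiE // => e; suff -> : S = A by [].
apply/setP => x; have [y /eqP <-] := psi_surj x.
by have /setP/(_ y) := e; rewrite !inE.
Qed.

Lemma order_iso_preimset (T T' : finType) (F : {set {set T}}) (F' : {set {set T'}}) psi :
  bijective psi -> (forall S, (S \in F) = (psi @^-1: S \in F')) ->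
  order_iso F F' (fun S => psi @^-1: S).
Proof.
move=> psiB FE; split=> [A|B BF|A B _ _]; first by rewrite FE.
  exists (psi @: B); last by apply: (imset_inj (bij_inj psiB)); rewrite imset_preimset.
  by rewrite FE (_ : _ @^-1: _ = B) //; apply: (imset_inj (bij_inj psiB)); rewrite imset_preimset.
by rewrite -(imset_sub_inj psiB) !imset_preimset.
Qed.

(** * From index sets of generators to sets of vertices *)

Section Relabel.
Variables (T : finType) (F : {set {set T}}) (rk : {set T} -> nat).
Hypothesis rfF : ranked_faces F rk.
Hypothesis botF : set0 \in F.
Hypothesis rk0 : rk set0 = 0.
Hypothesis edgeF : forall A, A \in F -> rk A = 2 -> #|atoms F rk set0 A| = 2.

Implicit Types (A B : {set T}).

(* The generators of a polytope may be redundant or repeated, so its vertices are taken to be the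
   atoms of its family of faces. *)
Definition vertex_of := {a : {set T} | a \in atoms F rk set0 setT}.
Definition vertices A : {set vertex_of} := [set a : vertex_of | val a \subset A].
Definition vertex_family := [set vertices A | A in F].
Definition unlabel (X : {set vertex_of}) := \bigcap_(A in F | X \subset vertices A) A.
Definition vertex_rank X := rk (unlabel X).

Lemma vertices_sub A B : A \in F -> B \in F -> (vertices A \subset vertices B) = (A \subset B).
Proof.
move=> AF BF; apply/subsetP/idP => [sub|AB a].
  apply: (atoms_inj rfF botF AF BF (sub0set _) (sub0set _) (subsetT _)) => a aA aH.
  by have := sub (Sub a aA); rewrite !inE /=; apply.
by rewrite !inE => /subset_trans; apply.
Qed.

Lemma verticesI A B : vertices (A :&: B) = vertices A :&: vertices B.
Proof. by apply/setP => a; rewrite !inE subsetI. Qed.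

Lemma unlabelK A : A \in F -> unlabel (vertices A) = A.
Proof.
move=> AF; apply/eqP; rewrite eqEsubset; apply/andP; split.
  by apply: bigcap_inf; rewrite AF subxx.
by apply/bigcapsP => B /andP[BF]; rewrite vertices_sub.
Qed.

Lemma vertices_proper A B : A \in F -> B \in F -> (vertices A \proper vertices B) = (A \proper B).
Proof. by move=> AF BF; rewrite !properE !vertices_sub. Qed.

Lemma vertices_iso : order_iso F vertex_family vertices.
Proof.
split=> [A AF|B /imsetP[A AF ->]|A B]; [exact: imset_f|by exists A|exact: vertices_sub].
Qed.

Lemma vertices_val (x : vertex_of) : vertices (val x) = [set x].
Proof.
have atomP (y : vertex_of) : val y \in F /\ rk (val y) = 1.
  by have := valP y; rewrite !inE rk0 => /and4P[? _ _ /eqP].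
apply/setP => y; rewrite !inE; apply/idP/eqP => [yx|-> //].
have [xF rx] := atomP x; have [yF ry] := atomP y.
by apply/val_inj/(rk_eq rfF) => //; rewrite rx ry.
Qed.

Lemma card_vertices A : #|vertices A| = #|atoms F rk set0 A|.
Proof.
rewrite -(card_imset _ val_inj); congr #|pred_of_set _|; apply/setP => a.
apply/imsetP/idP => [[x]|aA].
  rewrite inE => xA ->; have := valP x.
  by rewrite !inE /= => /and4P[-> -> _ ->]; rewrite xA.
have aA' : a \in atoms F rk set0 setT by move: aA; rewrite !inE subsetT => /and4P[-> -> _ ->].
exists (Sub a aA'); rewrite ?inE //=.
by move: aA; rewrite inE => /and4P[].
Qed.

Lemma vertex_family_faces : vertex_faces vertex_family vertex_rank.
Proof.
have vT : vertices setT = setT by apply/setP => a; rewrite !inE subsetT.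
have v0 : vertices set0 = set0.
  apply/eqP; rewrite -cards_eq0 card_vertices cards_eq0; apply/eqP/setP => a.
  rewrite !inE rk0; apply/negbTE/negP => /and4P[_ _]; rewrite subset0 => /eqP->.
  by rewrite rk0.
have atomF (x : vertex_of) : val x \in F /\ rk (val x) = 1.
  by have := valP x; rewrite !inE rk0 => /and4P[? _ _ /eqP].
split.
- split.
  + by rewrite -vT imset_f // (rf_top rfF).
  + move=> _ _ /imsetP[A AF ->] /imsetP[B BF ->]; rewrite -verticesI imset_f //.
    exact: (rf_meet rfF).
  + move=> _ _ /imsetP[A AF ->] /imsetP[B BF ->]; rewrite vertices_proper //.
    by rewrite /vertex_rank !unlabelK //; apply: (rf_mono rfF).
  move=> _ _ /imsetP[A AF ->] /imsetP[B BF ->]; rewrite vertices_proper //.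
  rewrite /vertex_rank !unlabelK // => AB /(rf_gap rfF AF BF AB)[K [L]].
  case=> KF LF [AK AL] [KB LB] e; exists (vertices K), (vertices L).
  by rewrite !imset_f // !vertices_proper // -verticesI e.
- by rewrite -v0 imset_f.
- by rewrite -v0 /vertex_rank unlabelK.
- by move=> x; rewrite -vertices_val imset_f //; case: (atomF x).
- by move=> x; have [xF rx] := atomF x; rewrite -vertices_val /vertex_rank unlabelK.
move=> _ /imsetP[A AF ->]; rewrite /vertex_rank unlabelK // card_vertices.
exact: edgeF.
Qed.

Lemma vertex_rank_top : vertex_rank setT = rk setT.
Proof.
have <- : vertices setT = setT by apply/setP => a; rewrite !inE subsetT.
by rewrite /vertex_rank unlabelK // (rf_top rfF).
Qed.

Lemma card_vertex_of : #|{: vertex_of}| = #|level F rk set0 setT 1|.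
Proof.
rewrite -cardsT -(card_vertices setT); congr #|pred_of_set _|.
by apply/setP => a; rewrite !inE subsetT.
Qed.

Lemma card_level_vertices j :
  #|level F rk set0 setT j| = #|level vertex_family vertex_rank set0 setT j|.
Proof.
have rk0' : vertex_rank set0 = 0 by case: vertex_family_faces.
have vI : {in F &, injective vertices}.
  by move=> A B AF BF e; rewrite -(unlabelK AF) e unlabelK.
rewrite -(card_in_imset (f := vertices) (D := level F rk set0 setT j)); last first.
  by move=> A B; rewrite !inE => /and4P[AF _ _ _] /and4P[BF _ _ _]; apply: vI.
congr #|pred_of_set _|; apply/setP => X; rewrite inE rk0' add0n sub0set subsetT /=.
apply/imsetP/andP => [[A]|[/imsetP[A AF ->]]].
  rewrite inE rk0 add0n => /and4P[AF _ _ /eqP rA] ->.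
  by rewrite imset_f // /vertex_rank unlabelK // rA.
rewrite /vertex_rank unlabelK // => rA; exists A => //.
by rewrite inE AF sub0set subsetT rk0 add0n.
Qed.

End Relabel.

From mathcomp Require Import all_order all_algebra boolp lra.

Import Order.TTheory GRing.Theory Num.Theory.

Local Open Scope ring_scope.

(** * Faces of a pointed vector configuration *)

Section Evaluation.
Variables (R : fieldType) (N : nat).
Implicit Types (l : 'cV[R]_N) (u v : 'rV[R]_N) (U : {vspace 'rV[R]_N}).

Definition ev l u : R := (u *m l) 0 0.

Lemma evDl l l' u : ev (l + l') u = ev l u + ev l' u.
Proof. by rewrite /ev mulmxDr mxE. Qed.

Lemma evZl c l u : ev (c *: l) u = c * ev l u.
Proof. by rewrite /ev -scalemxAr mxE. Qed.

Lemma evDr l u v : ev l (u + v) = ev l u + ev l v.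
Proof. by rewrite /ev mulmxDl mxE. Qed.

Lemma evZr c l u : ev l (c *: u) = c * ev l u.
Proof. by rewrite /ev -scalemxAl mxE. Qed.

Lemma ev0l u : ev 0 u = 0.
Proof. by rewrite /ev mulmx0 mxE. Qed.

Lemma ev_sum (J : Type) (r : seq J) (w : J -> R) (u : J -> 'rV[R]_N) l :
  ev l (\sum_(i <- r) w i *: u i) = \sum_(i <- r) w i * ev l (u i).
Proof.
rewrite /ev mulmx_suml summxE; apply: eq_bigr => i _.
by rewrite -scalemxAl mxE.
Qed.

Lemma ev_span l (s : seq 'rV[R]_N) u :
  (forall v, v \in s -> ev l v = 0) -> u \in <<s>>%VS -> ev l u = 0.
Proof.
move=> z us; pose f : 'Hom('rV[R]_N, 'M[R]_(1, 1)) := linfun (mulmxr l).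
have /subvP/(_ u us) : (<<s>> <= lker f)%VS.
  apply/span_subvP => v vs; rewrite memv_ker lfunE /=; apply/eqP/matrixP => i j.
  by rewrite !ord1 [RHS]mxE; exact: z.
by rewrite memv_ker lfunE /= => /eqP e; rewrite /ev e mxE.
Qed.

(** Some coordinate of [v] minus its projection to [U] is nonzero. *)
Lemma separating_functional U v : v \notin U ->
  exists2 l, (forall u, u \in U -> ev l u = 0) & ev l v != 0.
Proof.
move=> vU; pose h : 'End('rV[R]_N) := (\1 - projv U)%VF.
have hE u : h u = u - projv U u by rewrite add_lfunE opp_lfunE id_lfunE.
have : h v != 0 by rewrite hE subr_eq0; apply: contraNneq vU => ->; exact: memv_proj.
case/rV0Pn => j hj; exists (col j (lin1_mx h)) => [u uU|].
  by rewrite /ev colE mulmxA -colE mxE mul_rV_lin1 /= hE projv_id // subrr mxE.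
by rewrite /ev colE mulmxA -colE mxE mul_rV_lin1.
Qed.

End Evaluation.

Section Configuration.
Variables (R : realFieldType) (N : nat) (I : finType) (q : I -> 'rV[R]_N).
Hypothesis pointed : exists l, forall i, 0 < ev l (q i).
Implicit Types (S A B G H K : {set I}).

Definition supports l S := (forall i, 0 <= ev l (q i)) /\ S = [set i | ev l (q i) == 0].

(** The faces of the cone generated by the [q i], each recorded by the generators on it; [pointed]
    makes the apex of the cone, with no generator, a face. *)
Definition config_faces : {set {set I}} := [set S | `[< exists l, supports l S >]].

Definition config_rank S := \dim <<[seq q i | i <- enum S]>>%VS.

Lemma config_faceP S : reflect (exists l, supports l S) (S \in config_faces).
Proof. by rewrite inE; apply: asboolP. Qed.

Lemma config_bot : set0 \in config_faces.
Proof.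
have [l lq] := pointed; apply/config_faceP; exists l; split=> [i|]; first exact: ltW.
by apply/setP => i; rewrite !inE gt_eqF.
Qed.

Lemma config_rank0 : config_rank set0 = 0%N.
Proof. by rewrite /config_rank enum_set0 /= span_nil dimv0. Qed.

Lemma mem_config_span S i : i \in S -> q i \in <<[seq q i | i <- enum S]>>%VS.
Proof. by move=> iS; apply/memv_span/map_f; rewrite mem_enum. Qed.

Lemma config_span_sub A B : A \subset B ->
  (<<[seq q i | i <- enum A]>> <= <<[seq q i | i <- enum B]>>)%VS.
Proof.
move=> /subsetP AB; apply: sub_span => v /mapP[i]; rewrite mem_enum => /AB iB ->.
by apply: map_f; rewrite mem_enum.
Qed.

Lemma ev_config_span l S u : (forall i, i \in S -> ev l (q i) = 0) ->
  u \in <<[seq q i | i <- enum S]>>%VS -> ev l u = 0.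
Proof.
by move=> z; apply: ev_span => v /mapP[i]; rewrite mem_enum => /z zi ->.
Qed.

Lemma supports_notin l S i : supports l S -> i \notin S -> 0 < ev l (q i).
Proof. by move=> [pos ->]; rewrite inE lt_def pos andbT. Qed.

Lemma supports_in l S i : supports l S -> i \in S -> ev l (q i) = 0.
Proof. by move=> [pos ->]; rewrite inE => /eqP. Qed.

Lemma config_not_span l S i : supports l S -> i \notin S ->
  q i \notin <<[seq q i | i <- enum S]>>%VS.
Proof.
move=> lS iS; apply/negP => /(ev_config_span (fun i => supports_in lS)) e.
by have := supports_notin lS iS; rewrite e ltxx.
Qed.

Lemma config_mono A B : A \in config_faces -> B \in config_faces -> A \proper B ->
  (config_rank A < config_rank B)%N.
Proof.
move=> /config_faceP[l lA] _ /properP[AB [i iB iA]].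
have sub := config_span_sub AB.
rewrite ltn_neqAle dimvS // andbT; apply: contraTneq (config_not_span lA iA) => e.
rewrite negbK (_ : <<_>>%VS = <<[seq q i | i <- enum B]>>%VS) ?mem_config_span //.
by apply/eqP; rewrite eqEdim sub /= -/(config_rank A) e leqnn.
Qed.

(* Adding a large multiple of a functional supporting [G] turns a functional that is
   nonnegative on [G] only into one that is nonnegative everywhere. *)
Lemma face_of_face G h : G \in config_faces -> (forall i, i \in G -> 0 <= ev h (q i)) ->
  [set i in G | ev h (q i) == 0] \in config_faces.
Proof.
move=> /config_faceP[l lG] pos.
pose M := 1 + \sum_(i | i \notin G) `|ev h (q i)| / ev l (q i).
have Mi i : i \notin G -> 0 < ev (M *: l + h) (q i).
  move=> iG; have li := supports_notin lG iG; rewrite evDl evZl.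
  suff : `|ev h (q i)| < M * ev l (q i) by have := ler_norm (- ev h (q i)); rewrite normrN; lra.
  rewrite -ltr_pdivrMr // /M (bigD1 i) //= addrA.
  rewrite -[X in X < _]addr0; apply: ltr_leD; first by rewrite ltrDr.
  by apply: sumr_ge0 => j /andP[jG _]; rewrite divr_ge0 // ltW // (supports_notin lG).
have MG i : i \in G -> ev (M *: l + h) (q i) = ev h (q i).
  by move=> iG; rewrite evDl evZl (supports_in lG iG) mulr0 add0r.
apply/config_faceP; exists (M *: l + h); split.
  by move=> i; have [iG|iG] := boolP (i \in G); [rewrite MG // pos|exact/ltW/Mi].
apply/setP => i; rewrite !inE; have [iG|iG] /= := boolP (i \in G); first by rewrite MG.
by rewrite gt_eqF // Mi.
Qed.

(* The hyperplane [l = 0] is rotated about [F] in the direction [g] until it meets another point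
   of [G]. *)
Lemma rotate_face G l g F : G \in config_faces -> supports l F -> F \subset G ->
  (forall i, i \in F -> ev g (q i) = 0) ->
  (exists2 i, i \in G & ev g (q i) < 0) -> (exists2 i, i \in G & 0 < ev g (q i)) ->
  exists t, [/\ 0 < t, [set i in G | ev (l + t *: g) (q i) == 0] \in config_faces,
    F \proper [set i in G | ev (l + t *: g) (q i) == 0] &
    [set i in G | ev (l + t *: g) (q i) == 0] \proper G].
Proof.
move=> GF lF FG gF [i0 i0G gi0] [j0 j0G gj0].
pose P := [pred i | (i \in G) && (ev g (q i) < 0)].
have Pi0 : P i0 by rewrite /P /= i0G.
(* Ratio test: [i1] is the first point of [G] at which [l + t *: g] vanishes as [t] grows. *)
case: (arg_minP (fun i => ev l (q i) / - ev g (q i)) Pi0) => i1 /andP[i1G gi1] imin.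
have lpos i : i \in G -> 0 <= ev l (q i) by move=> _; case: lF.
have i1F : i1 \notin F by apply: contraTN gi1 => /gF->; rewrite ltxx.
have li1 := supports_notin lF i1F.
set t := ev l (q i1) / - ev g (q i1) in imin *.
have t0 : 0 < t by rewrite divr_gt0 // oppr_gt0.
have hE i : ev (l + t *: g) (q i) = ev l (q i) + t * ev g (q i) by rewrite evDl evZl.
have i1z : ev (l + t *: g) (q i1) = 0.
  by rewrite hE /t -mulrA invrN mulNr mulVf ?mulrN1 ?subrr // lt_eqF.
exists t; split=> //.
- apply: face_of_face => // i iG; rewrite hE.
  have [gi|gi] := ltrP (ev g (q i)) 0; last by rewrite addr_ge0 ?lpos // mulr_ge0 // ltW.
  have := imin i; rewrite /P /= iG gi => /(_ isT).
  by rewrite ler_pdivlMr ?oppr_gt0 // mulrN -subr_ge0 opprK.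
- apply/properP; split; last by exists i1 => //; rewrite inE i1G i1z eqxx.
  apply/subsetP => i iF; rewrite inE (subsetP FG) //= hE gF // mulr0 addr0.
  by rewrite (supports_in lF iF).
apply/properP; split; first by apply/subsetP => i; rewrite inE => /andP[].
exists j0; rewrite // inE j0G /= hE gt_eqF //.
by have := lpos _ j0G; have := mulr_gt0 t0 gj0; lra.
Qed.

(** Find a functional that vanishes on [A] and changes sign on [B], and rotate the supporting
    hyperplane of [A] along it and along its opposite. A point on both resulting faces where [l] is
    positive would give the functional both signs. *)
Lemma config_gap A B : A \in config_faces -> B \in config_faces -> A \proper B ->
  (config_rank A + 2 <= config_rank B)%N ->
  exists K L, [/\ K \in config_faces, L \in config_faces, A \proper K /\ A \proper L,
    K \proper B /\ L \proper B & K :&: L = A].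
Proof.
move=> AF BF /[dup] /properP[AB [j jB jA]] AsB gap.
have /config_faceP[l lA] := AF.
pose U := (<<[seq q i | i <- enum A]>> + <[q j]>)%VS.
have [i iB iU] : exists2 i, i \in B & q i \notin U.
  apply/exists_inP; apply: contraT; rewrite negb_exists_in => /forall_inP sub.
  have : (<<[seq q i | i <- enum B]>> <= U)%VS.
    apply/span_subvP => v /mapP[i]; rewrite mem_enum => /sub; rewrite negbK => ? ->.
    by [].
  have [le _] := dimv_add_leqif <<[seq q i | i <- enum A]>> <[q j]>.
  move=> /dimvS /leq_trans /(_ le) /(leq_trans gap).
  by rewrite leq_add2l dim_vline; case: (_ != 0).
have [g gU gi] := separating_functional iU.
have gA k : k \in A -> ev g (q k) = 0.
  by move=> kA; apply: gU; apply: subvP (addvSl _ _) _ _; apply: mem_config_span.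
have gj : ev g (q j) = 0 by apply: gU; apply: subvP (addvSr _ _) _ _; apply: memv_line.
have iA : i \notin A by apply: contraNN gi => /gA->.
have li := supports_notin lA iA; have lj := supports_notin lA jA.
(* Subtracting [mu *: l] from [g] halves the value at [i] and turns the zero at [j] into a value of
   the opposite sign. *)
pose mu := ev g (q i) / ev l (q i) / 2.
have mui : mu * ev l (q i) = ev g (q i) / 2.
  by rewrite /mu mulrAC divfK // gt_eqF.
have mu0 : mu != 0 by rewrite !mulf_neq0 // invr_eq0 ?gt_eqF.
pose f := g - mu *: l.
have fE k : ev f (q k) = ev g (q k) - mu * ev l (q k).
  by rewrite /f -scaleNr evDl evZl mulNr.
have fA k : k \in A -> ev f (q k) = 0.
  by move=> kA; rewrite fE gA // (supports_in lA kA) mulr0 subr0.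
have sign : exists f', [/\ forall k, k \in A -> ev f' (q k) = 0,
   exists2 k, k \in B & ev f' (q k) < 0 & exists2 k, k \in B & 0 < ev f' (q k)].
  have fi : ev f (q i) = ev g (q i) / 2 by rewrite fE mui; lra.
  have fj : ev f (q j) = - (mu * ev l (q j)) by rewrite fE gj sub0r.
  have [g0|g0] := ltrP 0 (ev g (q i)).
    exists f; split=> //; last by exists i => //; rewrite fi; lra.
    by exists j => //; rewrite fj oppr_lt0 mulr_gt0 // !divr_gt0.
  have {}g0 : ev g (q i) < 0 by rewrite lt_neqAle gi.
  exists f; split=> //; first by exists i => //; rewrite fi; lra.
  exists j => //; rewrite fj oppr_gt0 nmulr_rlt0 // /mu pmulr_llt0 ?invr_gt0 //.
  by rewrite pmulr_llt0 ?invr_gt0.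
have [f' [f'A neg pos]] := sign.
have [t [t0 KF AK KB]] := rotate_face BF lA AB f'A neg pos.
have f'N k : ev (- f') (q k) = - ev f' (q k) by rewrite -scaleN1r evZl mulN1r.
have [||| t' [t'0 LF AL LB]] := rotate_face BF lA AB (g := - f').
- by move=> k kA; rewrite f'N f'A // oppr0.
- by case: pos => k kB fk; exists k; rewrite // f'N oppr_lt0.
- by case: neg => k kB fk; exists k; rewrite // f'N oppr_gt0.
exists [set i in B | ev (l + t *: f') (q i) == 0], [set i in B | ev (l + t' *: - f') (q i) == 0].
split=> //; apply/eqP; rewrite eqEsubset; apply/andP; split; last first.
  by rewrite subsetI !proper_sub.
apply/subsetP => k; rewrite !inE !evDl !evZl f'N.
case/andP => /andP[kB /eqP e1] /andP[_ /eqP e2]; apply: contraT => kA.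
have lk := supports_notin lA kA.
have : ev f' (q k) < 0 by rewrite -(pmulr_rlt0 _ t0); lra.
have : 0 < ev f' (q k) by rewrite -(pmulr_rgt0 _ t'0); lra.
lra.
Qed.

Lemma config_ranked_faces : ranked_faces config_faces config_rank.
Proof.
split; [| |exact: config_mono|exact: config_gap].
  apply/config_faceP; exists 0; split=> [i|]; first by rewrite ev0l.
  by apply/setP => i; rewrite !inE ev0l eqxx.
move=> A B /config_faceP[l [lp lA]] /config_faceP[k [kp kB]].
apply/config_faceP; exists (l + k); split=> [i|]; first by rewrite evDl addr_ge0.
by apply/setP => i; rewrite lA kB !inE evDl paddr_eq0.
Qed.

(** Three distinct atoms would give generators with q k = x q i + y q j. The functionals supporting
    the first two atoms force x, y > 0; the one supporting the third vanishes at q k but is positive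
    at q i and q j. *)
Lemma config_edge E : E \in config_faces -> config_rank E = 2%N ->
  #|atoms config_faces config_rank set0 E| = 2%N.
Proof.
move=> EF rE; have rf := config_ranked_faces.
apply/eqP; rewrite eqn_leq; apply/andP; split; last first.
  have := leq_card_level rf 1 config_bot EF (sub0set _).
  by rewrite config_rank0 rE.
rewrite leqNgt; apply/negP => /card_gt2P[a [b [c [[aA bA cA] [ab bc ca]]]]].
have rep x : x \in atoms config_faces config_rank set0 E ->
  [/\ x \in config_faces, x \subset E & exists i, i \in x].
  rewrite inE config_rank0 => /and4P[xF _ xE /eqP rx]; split=> //.
  by apply/set0Pn; apply: contra_eq_neq rx => ->; rewrite config_rank0.
have disj x y i : x \in atoms config_faces config_rank set0 E ->
  y \in atoms config_faces config_rank set0 E -> x != y -> i \in x -> i \notin y.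
  move=> xA yA xy ix; apply: contra_neqN xy => iy.
  have [xF xE _] := rep x xA; have [yF yE _] := rep y yA.
  have mF : x :&: y \in config_faces by apply: (rf_meet rf).
  have r1 : (0 < config_rank (x :&: y))%N.
    rewrite -config_rank0; apply: config_mono => //; first exact: config_bot.
    by rewrite proper0; apply/set0Pn; exists i; rewrite inE ix.
  have : x :&: y = x /\ x :&: y = y.
    move: xA yA; rewrite !inE config_rank0 => /and4P[_ _ _ /eqP rx] /and4P[_ _ _ /eqP ry].
    split; apply: (rk_eq rf) => //; rewrite ?subsetIl ?subsetIr // ?rx ?ry //.
  by case=> e1 e2; rewrite -[LHS]e1.
have [aF aE [i ia]] := rep a aA; have [bF bE [j jb]] := rep b bA; have [cF cE [k kc]] := rep c cA.
have /config_faceP[la sa] := aF; have /config_faceP[lb sb] := bF; have /config_faceP[lc sc] := cF.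
have ba : b != a by rewrite eq_sym.
have ac : a != c by rewrite eq_sym.
have cb : c != b by rewrite eq_sym.
have laj := supports_notin sa (disj _ _ _ bA aA ba jb).
have lak := supports_notin sa (disj _ _ _ cA aA ca kc).
have lbi := supports_notin sb (disj _ _ _ aA bA ab ia).
have lbk := supports_notin sb (disj _ _ _ cA bA cb kc).
have lci := supports_notin sc (disj _ _ _ aA cA ac ia).
have lcj := supports_notin sc (disj _ _ _ bA cA bc jb).
have lai := supports_in sa ia; have lbj := supports_in sb jb; have lck := supports_in sc kc.
have qj0 : q j != 0 by apply: contraTneq laj => ->; rewrite -(scale0r 0) evZr mul0r ltxx.
have sub : (<[q i]> + <[q j]> <= <<[seq q i | i <- enum E]>>)%VS.
  rewrite subv_add -!memvE; apply/andP; split; apply: mem_config_span.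
    exact: subsetP aE _ ia.
  exact: subsetP bE _ jb.
have qk : q k \in (<[q i]> + <[q j]>)%VS.
  suff -> : (<[q i]> + <[q j]> = <<[seq q i | i <- enum E]>>)%VS.
    exact: mem_config_span (subsetP cE _ kc).
  apply/eqP; rewrite eqEdim sub /= -/(config_rank E) rE ltnNge; apply/negP => d1.
  have /vlineP[x ex] : q i \in <[q j]>%VS.
    suff -> : (<[q j]> = <[q i]> + <[q j]>)%VS by apply: subvP (addvSl _ _) _ _; apply: memv_line.
    by apply/eqP; rewrite eqEdim addvSr dim_vline qj0.
  by move: lbi; rewrite ex evZr lbj mulr0 ltxx.
have [_ /vlineP[x ->] [_ /vlineP[y ->] ek]] := memv_addP qk.
move: lak lbk lck; rewrite ek !evDr !evZr lai lbj !mulr0 add0r addr0 => y0 x0.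
have {}y0 : 0 < y by rewrite -(pmulr_lgt0 _ laj).
have {}x0 : 0 < x by rewrite -(pmulr_lgt0 _ lbi).
have := mulr_gt0 x0 lci; have := mulr_gt0 y0 lcj; lra.
Qed.

End Configuration.

Require Import Defs.
From mathcomp Require Import finmap.
From mathcomp Require Import classical_sets functions cardinality reals.

Local Open Scope classical_set_scope.
Local Open Scope ring_scope.

(** * Polytopes as point configurations *)

Lemma sum_enum_val (I : finType) (V : nmodType) (f : I -> V) :
  \sum_(j < #|I|) f (enum_val j) = \sum_i f i.
Proof.
rewrite [RHS](reindex (fun j : 'I_#|I| => enum_val j)) //.
by exists enum_rank => j _; [exact: enum_valK|exact: enum_rankK].
Qed.

Section Hull.
Variables (R : realType) (n : nat).
Implicit Types (x : 'rV[R]_n) (A : set 'rV[R]_n).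

Lemma conv_hull_rangeP (I : finType) (p : I -> 'rV[R]_n) x :
  conv_hull (range p) x <->
  exists w : I -> R, [/\ forall i, 0 <= w i, \sum_i w i = 1 & x = \sum_i w i *: p i].
Proof.
split=> [[r [y [w [yp w0 w1 ->]]]]|[w [w0 w1 ->]]].
  have sig j : exists i, p i = y j by have [i _ e] := yp j; exists i.
  pose f j := sval (cid (sig j)); have fE j : p (f j) = y j by rewrite /f; case: cid.
  exists (fun i => \sum_(j | f j == i) w j); split.
  - by move=> i; apply: sumr_ge0.
  - by rewrite -w1 [RHS](partition_big f xpredT).
  rewrite (partition_big f xpredT) //=; apply: eq_bigr => i _.
  by rewrite scaler_suml; apply: eq_bigr => j /eqP <-; rewrite fE.
exists #|I|, (fun j => p (enum_val j)), (fun j => w (enum_val j)); split=> //.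
  by rewrite (sum_enum_val w).
by rewrite (sum_enum_val (fun i => w i *: p i)).
Qed.

Lemma conv_hull_incl A x : A x -> conv_hull A x.
Proof.
move=> Ax; exists 1%N, (fun=> x), (fun=> 1); split=> //.
  by rewrite big_ord1.
by rewrite big_ord1 scale1r.
Qed.

Lemma conv_hull_sub (I : finType) (p : I -> 'rV[R]_n) A :
  A `<=` conv_hull (range p) -> conv_hull A `<=` conv_hull (range p).
Proof.
move=> sub x [r [y [w [yA w0 w1 ->]]]]; apply/conv_hull_rangeP.
have uE j := proj1 (conv_hull_rangeP p (y j)) (sub _ (yA j)).
pose u j := sval (cid (uE j)).
have uP j : [/\ forall i, 0 <= u j i, \sum_i u j i = 1 & y j = \sum_i u j i *: p i].
  by rewrite /u; case: cid.
exists (fun i => \sum_j w j * u j i); split.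
- by move=> i; apply: sumr_ge0 => j _; rewrite mulr_ge0 //; case: (uP j).
- rewrite exchange_big /= -w1; apply: eq_bigr => j _.
  by rewrite -mulr_sumr; case: (uP j) => _ -> _; rewrite mulr1.
under [RHS]eq_bigr do rewrite scaler_suml.
rewrite exchange_big /=; apply: eq_bigr => j _.
have [_ _ ->] := uP j; rewrite scaler_sumr; apply: eq_bigr => i _.
by rewrite scalerA.
Qed.

Lemma conv_hullS A B : A `<=` B -> conv_hull A `<=` conv_hull B.
Proof.
by move=> AB x [r [y [w [yA w0 w1 ->]]]]; exists r, y, w; split=> // i; apply: AB.
Qed.

End Hull.

Section Lift.
Variables (R : realType) (n : nat).
Implicit Types (x : 'rV[R]_n).

Definition lift_pt x : 'rV[R]_(1 + n) := row_mx 1 x.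

Definition affine_form (c : 'cV[R]_n) (b : R) : 'cV[R]_(1 + n) := col_mx b%:M (- c).

Lemma ev_affine_form c b x : ev (affine_form c b) (lift_pt x) = b - (x *m c) 0 0.
Proof. by rewrite /ev mul_row_col mul1mx mulmxN !mxE eqxx mulr1n. Qed.

Lemma affine_formP (l : 'cV[R]_(1 + n)) : exists c b, l = affine_form c b.
Proof.
exists (- dsubmx l), (usubmx l 0 0); rewrite /affine_form opprK.
by rewrite -mx11_scalar vsubmxK.
Qed.

Lemma lift_pt_sum (J : Type) (r : seq J) (w : J -> R) (p : J -> 'rV[R]_n) :
  \sum_(i <- r) w i = 1 ->
  lift_pt (\sum_(i <- r) w i *: p i) = \sum_(i <- r) w i *: lift_pt (p i).
Proof.
move=> w1; rewrite -[RHS]hsubmxK !linear_sum /=; congr row_mx.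
  under eq_bigr do rewrite linearZ /= row_mxKl.
  by rewrite -scaler_suml w1 scale1r.
by apply: eq_bigr => i _; rewrite linearZ /= row_mxKr.
Qed.

End Lift.

Section PolytopeFaces.
Variables (R : realType) (n : nat) (I : finType) (p : I -> 'rV[R]_n).
Let P : set 'rV[R]_n := conv_hull (range p).
Let q i := lift_pt (p i).
Local Notation faces := (config_faces q).
Local Notation rank := (config_rank q).
Implicit Types (F G : set 'rV[R]_n) (x : 'rV[R]_n) (S : {set I}).

Lemma lift_pointed : exists l, forall i, 0 < ev l (q i).
Proof.
by exists (affine_form 0 1) => i; rewrite ev_affine_form mulmx0 mxE subr0 ltr01.
Qed.

Lemma vertex_in i : P (p i). Proof. by apply: conv_hull_incl; exists i. Qed.

Definition carrier F : {set I} := finset (fun i => `[< F (p i) >]).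

Lemma in_carrier F i : (i \in carrier F) = `[< F (p i) >].
Proof. by rewrite inE. Qed.

Lemma config_faces_affineP S : (S \in faces) <->
  exists (c : 'cV[R]_n) (b : R), forall i,
    (p i *m c) 0 0 <= b /\ ((p i *m c) 0 0 == b) = (i \in S).
Proof.
split=> [/config_faceP[l]|[c [b cb]]].
  have [c [b ->]] := affine_formP l; move=> [pos ->]; exists c, b => i.
  by have := pos i; rewrite inE ev_affine_form subr_ge0 subr_eq0 eq_sym.
apply/config_faceP; exists (affine_form c b); split=> [i|].
  by rewrite ev_affine_form subr_ge0; case: (cb i).
by apply/setP => i; rewrite inE ev_affine_form subr_eq0 eq_sym; case: (cb i).
Qed.

Lemma hull_valid (c : 'cV[R]_n) (b : R) : (forall i, (p i *m c) 0 0 <= b) ->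
  forall x, P x -> (x *m c) 0 0 <= b.
Proof.
move=> cb x /conv_hull_rangeP[w [w0 w1 ->]].
have := ev_sum (index_enum I) w p c; rewrite /ev => ->.
by rewrite -[b]mul1r -w1 mulr_suml; apply: ler_sum => i _; apply: ler_wpM2l.
Qed.

(** The slack at [x] is the weighted sum of the nonnegative slacks at the generators. *)
Lemma hull_tight F x (w : I -> R) : is_face P F -> (forall i, 0 <= w i) ->
  \sum_i w i = 1 -> x = \sum_i w i *: p i ->
  F x <-> forall i, w i != 0 -> F (p i).
Proof.
move=> [c [b [valid ->]]] w0 w1 xE.
have Px : P x by apply/conv_hull_rangeP; exists w.
have xc : (x *m c) 0 0 = \sum_i w i * (p i *m c) 0 0.
  by rewrite xE; exact: (ev_sum (index_enum I) w p c).
have slack : b - (x *m c) 0 0 = \sum_i w i * (b - (p i *m c) 0 0).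
  by rewrite xc -[b in LHS]mul1r -w1 mulr_suml -sumrB; apply: eq_bigr => i _; rewrite mulrBr.
have term i : 0 <= w i * (b - (p i *m c) 0 0).
  by rewrite mulr_ge0 // subr_ge0; apply: valid; apply: vertex_in.
split=> [[_ e] i wi|tight] /=.
  split; first exact: vertex_in.
  move: slack; rewrite e subrr => /esym/eqP; rewrite psumr_eq0 //.
  move=> /allP/(_ i (mem_index_enum i)) /=; rewrite mulf_eq0 (negPf wi) /= subr_eq0.
  by move=> /eqP.
split=> //; apply/eqP; rewrite eq_sym -subr_eq0 slack psumr_eq0 //.
apply/allP => i _ /=; rewrite mulf_eq0; have [//|/tight[_ ->]] := eqVneq (w i) 0.
by rewrite subrr eqxx.
Qed.

Lemma carrier_face F : is_face P F -> carrier F \in faces.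
Proof.
move=> [c [b [valid ->]]]; apply/config_faces_affineP; exists c, b => i.
split; first exact/valid/vertex_in.
rewrite in_carrier; apply/eqP/asboolP => [e|[]] //; split=> //; exact: vertex_in.
Qed.

Lemma face_of_carrier S : S \in faces -> exists F, is_face P F /\ carrier F = S.
Proof.
move=> /config_faces_affineP[c [b cb]]; exists [set x | P x /\ (x *m c) 0 0 = b]; split.
  by exists c, b; split=> // x; apply: hull_valid => i; case: (cb i).
apply/setP => i; rewrite in_carrier; have [_ <-] := cb i.
apply/asboolP/eqP => [[]|e] //; split=> //; exact: vertex_in.
Qed.

Lemma face_sub_hull F : is_face P F -> F `<=` P.
Proof. by move=> [c [b [_ ->]]] x []. Qed.

Lemma carrier_sub F G : is_face P F -> is_face P G ->
  F `<=` G <-> (carrier F \subset carrier G).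
Proof.
move=> fF fG; split=> [FG|/fintype.subsetP sub x Fx].
  by apply/fintype.subsetP => i; rewrite !in_carrier => /asboolP Fi; apply/asboolP/FG.
have /conv_hull_rangeP[w [w0 w1 xE]] := face_sub_hull fF Fx.
apply/(hull_tight fG w0 w1 xE) => i wi.
have := sub i; rewrite !in_carrier => h; apply/asboolP/h/asboolP.
exact: (proj1 (hull_tight fF w0 w1 xE) Fx).
Qed.

Lemma carrier_inj F G : is_face P F -> is_face P G -> carrier F = carrier G -> F = G.
Proof.
by move=> fF fG e; apply/seteqP; split; apply/carrier_sub => //; rewrite e subxx.
Qed.

Lemma aff_hull_face F : is_face P F ->
  aff_hull F = [set x | lift_pt x \in <<[seq q i | i <- enum (carrier F)]>>%VS].
Proof.
move=> fF; apply/seteqP; split=> x /=.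
  move=> [r [y [w [yF w1 ->]]]]; rewrite lift_pt_sum //.
  apply: memv_suml => j _; apply: memvZ.
  have /conv_hull_rangeP[u [u0 u1 yE]] := face_sub_hull fF (yF j).
  rewrite yE lift_pt_sum //; apply: memv_suml => i _.
  have [->|ui] := eqVneq (u i) 0; first by rewrite scale0r mem0v.
  apply/memvZ/mem_config_span; rewrite in_carrier; apply/asboolP.
  exact: (proj1 (hull_tight fF u0 u1 yE) (yF j)).
set X := [seq q i | i <- enum (carrier F)] => xX.
have XP (j : 'I_(size X)) : exists2 i, F (p i) & X`_j = q i.
  have /mapP[i] : X`_j \in X by apply: mem_nth.
  by rewrite mem_enum in_carrier => /asboolP; exists i.
have xE : lift_pt x = \sum_(j < size X) coord (in_tuple X) j (lift_pt x) *: X`_j.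
  by rewrite {1}(coord_span (X := in_tuple X) xX).
exists (size X), (fun j => rsubmx (X`_j : 'rV_(1 + n))),
  (fun j => coord (in_tuple X) j (lift_pt x)); split.
- by move=> j; have [i Fi ->] := XP j; rewrite row_mxKr.
(* All lifted points have first coordinate 1, so the coefficients sum to 1. *)
- have := congr1 (fun v : 'rV_(1 + n) => (lsubmx v) 0 0) xE.
  rewrite row_mxKl linear_sum summxE !mxE eqxx mulr1n => ->; apply: eq_bigr => j _.
  by have [i _ ->] := XP j; rewrite linearZ /= row_mxKl !mxE eqxx mulr1.
have := congr1 (fun v : 'rV_(1 + n) => rsubmx v) xE.
by rewrite row_mxKr linear_sum => {1}->; apply: eq_bigr => j _; rewrite linearZ.
Qed.

Definition direction : 'Hom('rV[R]_n, 'rV[R]_(1 + n)) := linfun (mulmxr (row_mx 0 1%:M)).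

Lemma directionE w : direction w = row_mx 0 w.
Proof. by rewrite lfunE /= mul_mx_row mulmx0 mulmx1. Qed.

(** The linear span is the direct sum of the line through the lift of [x0] and the copy of [W] at
    height 0. *)
Lemma rank_has_dim F m : is_face P F -> has_dim F m -> rank (carrier F) = m.+1.
Proof.
move=> fF [x0 [W [aff <-]]]; rewrite (aff_hull_face fF) in aff.
have affP x : (lift_pt x \in <<[seq q i | i <- enum (carrier F)]>>%VS) = (x - x0 \in W).
  apply/idP/idP => [xU|xW].
    have : [set x0 + w | w in [set` W]] x by rewrite -aff.
    by case=> w /= wW <-; rewrite addrAC subrr add0r.
  have : [set x0 + w | w in [set` W]] x by exists (x - x0) => //=; rewrite addrC subrK.
  by rewrite -aff.
have x0U : lift_pt x0 \in <<[seq q i | i <- enum (carrier F)]>>%VS.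
  by rewrite affP subrr mem0v.
have liftE x : lift_pt x = lift_pt x0 + direction (x - x0).
  by rewrite directionE add_row_mx addr0 addrC subrK.
rewrite /config_rank.
have -> : <<[seq q i | i <- enum (carrier F)]>>%VS = (<[lift_pt x0]> + direction @: W)%VS.
  apply/eqP; rewrite eqEsubv; apply/andP; split.
    apply/span_subvP => v vX; have vU := memv_span vX.
    move: vX => /mapP[i _ ev]; rewrite ev /q liftE in vU *.
    apply: memv_add (memv_line _) (memv_img _ _); rewrite -affP liftE //.
  rewrite subv_add -memvE x0U /=; apply/subvP => _ /memv_imgP[w wW ->].
  have -> : direction w = lift_pt (x0 + w) - lift_pt x0.
    by rewrite liftE addrAC subrr add0r addrAC subrr add0r.
  by rewrite memvB // affP addrAC subrr add0r.
have disj : (<[lift_pt x0]> :&: direction @: W = 0)%VS.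
  apply/eqP; rewrite -subv0; apply/subvP => v; rewrite memv_cap memv0.
  case/andP=> /vlineP[t ->] /memv_imgP[w _]; rewrite directionE scale_row_mx.
  move/eq_row_mx => [e _]; have := congr1 (fun M : 'M_(1, 1) => M 0 0) e.
  by rewrite !mxE eqxx mulr1 => ->; rewrite !scale0r row_mx0.
rewrite dimv_disjoint_sum // dim_vline limg_dim_eq.
  suff -> : lift_pt x0 != 0 by [].
  apply/eqP => e; have := congr1 (fun v : 'rV_(1 + n) => (lsubmx v) 0 0) e.
  by rewrite row_mxKl !mxE eqxx => /eqP; rewrite oner_eq0.
apply/eqP; rewrite -subv0; apply/subvP => v; rewrite memv_cap memv0 memv_ker directionE.
case/andP=> _ /eqP e; have := congr1 (fun v : 'rV_(1 + n) => rsubmx v) e.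
by rewrite row_mxKr => ->; rewrite linear0.
Qed.

(** For the converse it is enough that [F] has some dimension; [rank_has_dim] then identifies it. *)
Lemma has_dimP F m : is_face P F -> has_dim F m <-> rank (carrier F) = m.+1.
Proof.
move=> fF; split=> [|rF]; first exact: rank_has_dim.
have /set0Pn[i0 iF] : carrier F != finset.set0.
  by apply: contra_eq_neq rF => ->; rewrite config_rank0.
set U := <<[seq q i | i <- enum (carrier F)]>>%VS.
have i0U : lift_pt (p i0) \in U by apply: mem_config_span.
pose W := (direction @^-1: U)%VS.
have aff : aff_hull F = [set p i0 + w | w in [set` W]].
  have WE w : (w \in W) = (lift_pt (p i0 + w) \in U).
    rewrite -memv_preim directionE.
    have -> : lift_pt (p i0 + w) = lift_pt (p i0) + row_mx 0 w by rewrite add_row_mx addr0.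
    by rewrite rpredDl.
  rewrite (aff_hull_face fF); apply/seteqP; split=> [x /= xU|_ [w /= wW <-]].
    by exists (x - p i0); rewrite /= ?WE addrC subrK.
  by rewrite -WE.
have hW : has_dim F (\dim W) by exists (p i0), W.
by have := rank_has_dim fF hW; rewrite rF => -[->].
Qed.

(** The m-faces form the image of a finite level under an injection, so [fset_set] does not fall
    back to its default. *)
Lemma fnumE m : fnum m P = #|level faces rank finset.set0 finset.setT m.+1|.
Proof.
pose L := level faces rank finset.set0 finset.setT m.+1.
have LP S : (S \in L) = (S \in faces) && (rank S == m.+1).
  by rewrite inE finset.sub0set finset.subsetT config_rank0 add0n.
have ex S : exists F, S \in L -> is_face P F /\ carrier F = S.
  have [SL|_] := boolP (S \in L); last by exists point.
  by move: SL; rewrite LP => /andP[/face_of_carrier[F]]; exists F.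
pose g S := sval (cid (ex S)).
have gP S : S \in L -> is_face P (g S) /\ carrier (g S) = S by rewrite /g; case: cid.
have gI : {in L &, injective g}.
  by move=> S S' /gP[_ {2}<-] /gP[_ {2}<-] ->.
rewrite /fnum (_ : [set F | _] = [set` (imfset imfset_key g (mem L))]).
  by rewrite set_fsetK card_in_imfset //= -cardE.
apply/seteqP; split=> [F [fF /(has_dimP m fF) rF]|F /= /imfsetP[S /= /[dup] SL /gP[fS cS] ->]].
  have cL : carrier F \in L by rewrite LP carrier_face // rF eqxx.
  apply/imfsetP; exists (carrier F) => //.
  by have [f1 e1] := gP _ cL; apply: carrier_inj.
split=> //; apply/(has_dimP m fS).
by move: SL; rewrite LP cS => /andP[_ /eqP].
Qed.

End PolytopeFaces.

Section CombEquiv.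
Variables (R : realType) (n n' : nat) (I I' : finType).
Variables (p : I -> 'rV[R]_n) (p' : I' -> 'rV[R]_n').
Local Notation P := (conv_hull (range p)).
Local Notation P' := (conv_hull (range p')).
Local Notation faces := (config_faces (fun i => lift_pt (p i))).
Local Notation faces' := (config_faces (fun i => lift_pt (p' i))).

Lemma comb_equivP : comb_equiv P P' <-> exists phi, order_iso faces faces' phi.
Proof.
have face_ex S : exists F, S \in faces -> is_face P F /\ carrier p F = S.
  have [/face_of_carrier[F]|_] := boolP (S \in faces); first by exists F.
  by exists point.
pose g S := sval (cid (face_ex S)).
have gP S : S \in faces -> is_face P (g S) /\ carrier p (g S) = S by rewrite /g; case: cid.
have face_ex' S : exists F, S \in faces' -> is_face P' F /\ carrier p' F = S.
  have [/face_of_carrier[F]|_] := boolP (S \in faces'); first by exists F.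
  by exists point.
pose g' S := sval (cid (face_ex' S)).
have gP' S : S \in faces' -> is_face P' (g' S) /\ carrier p' (g' S) = S by rewrite /g'; case: cid.
split=> [[f [[ffun finj fsurj] fmono]]|[phi [phi1 phi2 phi3]]].
  exists (fun S => carrier p' (f (g S))); split=> [S SF|S' /gP'[fS' cS']|S1 S2 SF1 SF2].
  - by have [fS _] := gP S SF; apply: carrier_face; apply: ffun.
  - have [F fF eF] := fsurj _ fS'; exists (carrier p F); first exact: carrier_face.
    have [fg cg] := gP _ (carrier_face fF).
    by rewrite (carrier_inj fg fF cg) eF.
  have [f1 c1] := gP _ SF1; have [f2 c2] := gP _ SF2.
  apply/idP/idP => [h|].
    rewrite -c1 -c2; apply/(carrier_sub f1 f2)/(fmono _ _ f1 f2).
    by apply/(carrier_sub (ffun _ f1) (ffun _ f2)).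
  rewrite -{1}c1 -{1}c2 => /(carrier_sub f1 f2)/(fmono _ _ f1 f2).
  by move=> /(carrier_sub (ffun _ f1) (ffun _ f2)).
have hP F : is_face P F -> is_face P' (g' (phi (carrier p F))) /\
    carrier p' (g' (phi (carrier p F))) = phi (carrier p F).
  by move=> fF; apply/gP'/phi1/carrier_face.
have hmono F G : is_face P F -> is_face P G ->
    (F `<=` G <-> g' (phi (carrier p F)) `<=` g' (phi (carrier p G))).
  move=> fF fG; have [f1 c1] := hP F fF; have [f2 c2] := hP G fG.
  split=> [/(carrier_sub fF fG) h|/(carrier_sub f1 f2)].
    by apply/(carrier_sub f1 f2); rewrite c1 c2 phi3 // carrier_face.
  by rewrite c1 c2 phi3 ?carrier_face // => /(carrier_sub fF fG).
exists (fun F => g' (phi (carrier p F))); split; last exact: hmono.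
split=> [F /= /hP[]//|F G /set_mem fF /set_mem fG e|F' /= fF'].
  by apply/seteqP; split; apply/hmono => //; rewrite e.
have [S SF eS] := phi2 _ (carrier_face fF').
have [fS cS] := gP S SF; exists (g S) => //.
have [f1 c1] := hP _ fS; apply: (carrier_inj f1 fF').
by rewrite c1 cS.
Qed.

End CombEquiv.

(** * The triplex model *)

Section Pyramid.
Variables (R : realType) (n : nat) (I I' : finType).
Variables (p : I -> 'rV[R]_n) (p' : I' -> 'rV[R]_(1 + n)) (e : I -> I') (apex : I').
Hypothesis pe : forall i, p' (e i) = row_mx 0 (p i).
Hypothesis papex : p' apex = row_mx (const_mx 1) 0.
Hypothesis cover : forall z, z = apex \/ exists i, z = e i.

Lemma pyramid_hull : pyramid (conv_hull (range p)) = conv_hull (range p').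
Proof.
apply/seteqP; split.
  apply: conv_hull_sub => _ [[x /conv_hull_rangeP[w [w0 w1 ->]] <-]|->]; last first.
    by rewrite -papex; apply: conv_hull_incl; exists apex.
  exists #|I|, (fun j => row_mx 0 (p (enum_val j))), (fun j => w (enum_val j)).
  split=> // [j||]; first by rewrite -pe; exists (e (enum_val j)).
    by rewrite (sum_enum_val w).
  rewrite (sum_enum_val (fun i => w i *: row_mx 0 (p i))).
  rewrite -[RHS]hsubmxK !linear_sum /=; congr row_mx.
    by rewrite big1 // => i _; rewrite linearZ /= row_mxKl scaler0.
  by apply: eq_bigr => i _; rewrite linearZ /= row_mxKr.
apply: conv_hullS => _ [z _ <-]; have [->|[i ->]] := cover z; first by right.
by left; exists (p i); rewrite ?pe //; apply: vertex_in.
Qed.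

Lemma pyramid_faces (S : {set I'}) :
  (S \in config_faces (fun z => lift_pt (p' z))) =
  (e @^-1: S \in config_faces (fun i => lift_pt (p i))).
Proof.
apply/idP/idP => /config_faces_affineP[c [b cb]]; apply/config_faces_affineP.
  exists (dsubmx c), b => i; have := cb (e i).
  have -> : p' (e i) *m c = p i *m dsubmx c.
    by rewrite pe -{1}[c]vsubmxK mul_row_col mul0mx add0r.
  by rewrite inE.
(* The coefficient of the height coordinate is the value at the apex and does not affect the base:
   [b] puts the apex on the hyperplane, b - 1 strictly below it. *)
pose t : R := if apex \in S then b else b - 1.
exists (col_mx t%:M c), b => z; have [->|[i ->]] := cover z.
  rewrite papex mul_row_col mul0mx addr0 mul_mx_scalar !mxE mulr1 /t.
  case: (apex \in S); first by rewrite lexx eqxx.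
  split; first by rewrite gerBl ler01.
  by apply/negbTE; rewrite lt_eqF // gtrBl ltr01.
by rewrite pe mul_row_col mul0mx add0r; have := cb i; rewrite inE.
Qed.

End Pyramid.

Lemma fold_pyramid_config (R : realType) (n : nat) (Y : finType) (p : Y -> 'rV[R]_n) (j : nat) :
  exists p' : 'I_j + Y -> 'rV[R]_(j + n),
  fold_pyramid j (conv_hull (range p)) = conv_hull (range p') /\
  forall S : {set 'I_j + Y}, (S \in config_faces (fun z => lift_pt (p' z))) =
    (inr @^-1: S \in config_faces (fun i => lift_pt (p i))).
Proof.
elim: j => [|j [p0 [hull0 faces0]]].
  exists (fun z => match z with inl i => 0 | inr y => p y end); split=> [|S] /=.
    congr conv_hull; apply/seteqP; split=> _ [y _ <-]; first by exists (inr y).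
    by case: y => [[]|y] //; exists y.
  apply/idP/idP => /config_faces_affineP[c [b cb]]; apply/config_faces_affineP; exists c, b.
    by move=> y; have := cb (inr y); rewrite inE.
  by case=> [[]|y] //; have := cb y; rewrite inE.
pose e (z : 'I_j + Y) : 'I_j.+1 + Y := match z with inl i => inl (lift ord0 i) | inr y => inr y end.
pose p1 (z : 'I_j.+1 + Y) : 'rV[R]_(1 + (j + n)) := match z with
  | inl i => if unlift ord0 i is Some i' then row_mx 0 (p0 (inl i')) else row_mx (const_mx 1) 0
  | inr y => row_mx 0 (p0 (inr y)) end.
have pe z : p1 (e z) = row_mx 0 (p0 z) by case: z => [i|y] //=; rewrite liftK.
have papex : p1 (inl ord0) = row_mx (const_mx 1) 0 by rewrite /= unlift_none.
have cover z : z = inl ord0 \/ exists i, z = e i.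
  case: z => [i|y]; last by right; exists (inr y).
  case: (unliftP ord0 i) => [i' ->|->]; last by left.
  by right; exists (inl i').
exists p1; split=> [|S] /=; first by rewrite hull0 (pyramid_hull pe papex cover).
rewrite (pyramid_faces pe papex cover) faces0.
suff -> : inr @^-1: (e @^-1: S) = inr @^-1: S by [].
by apply/setP => y; rewrite !inE.
Qed.

Section Prism.
Variables (R : realType) (k : nat).

Definition prism_pt (z : 'I_k * bool) : 'rV[R]_(k + 1) :=
  row_mx (delta_mx 0 z.1) (if z.2 then const_mx 1 else 0).

Lemma segment01E : segment01 R =
  conv_hull (range (fun e : bool => if e then const_mx 1 else 0 : 'rV[R]_1)).
Proof.
congr conv_hull; apply/seteqP; split=> [_ [->|->]|_ [[] _ <-]].
- by exists false.
- by exists true.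
- by right.
- by left.
Qed.

Lemma prism_hull : simplicial_prism R k = conv_hull (range prism_pt).
Proof.
apply/seteqP; split=> z.
  case=> /conv_hull_rangeP[u [u0 u1 uE]]; rewrite segment01E => /conv_hull_rangeP[v [v0 v1 vE]].
  apply/conv_hull_rangeP; exists (fun y => u y.1 * v y.2); split=> [y||].
  - by rewrite mulr_ge0.
  - rewrite -(pair_bigA _ (fun i e => u i * v e)) /= -u1; apply: eq_bigr => i _.
    by rewrite -mulr_sumr v1 mulr1.
  rewrite -[LHS]hsubmxK -[RHS]hsubmxK !linear_sum /=; congr row_mx.
    rewrite uE -(pair_bigA _ (fun i e => lsubmx ((u i * v e) *: prism_pt (i, e)))) /=.
    apply: eq_bigr => i _.
    rewrite (eq_bigr (fun e => v e *: (u i *: delta_mx 0 i))) => [|e _].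
      by rewrite -scaler_suml v1 scale1r.
    by rewrite linearZ /= row_mxKl scalerA mulrC.
  rewrite vE -(pair_bigA _ (fun i e => rsubmx ((u i * v e) *: prism_pt (i, e)))) /=.
  rewrite exchange_big /=; apply: eq_bigr => e _.
  rewrite (eq_bigr (fun i => u i *: (v e *: (if e then const_mx 1 else 0)))) => [|i _].
    by rewrite -scaler_suml u1 scale1r.
  by rewrite linearZ /= row_mxKr scalerA.
case/conv_hull_rangeP => w [w0 w1 ->]; split.
  apply/conv_hull_rangeP; exists (fun i => \sum_e w (i, e)); split=> [i||].
  - exact: sumr_ge0.
  - by rewrite pair_bigA /= -w1; apply: eq_bigr => -[].
  rewrite linear_sum /=; under [RHS]eq_bigr do rewrite scaler_suml.
  rewrite pair_bigA /=; apply: eq_bigr => -[i e] _ /=.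
  by rewrite linearZ /= row_mxKl.
rewrite segment01E; apply/conv_hull_rangeP; exists (fun e => \sum_i w (i, e)); split=> [e||].
- exact: sumr_ge0.
- by rewrite exchange_big pair_bigA /= -w1; apply: eq_bigr => -[].
rewrite linear_sum /=; under [RHS]eq_bigr do rewrite scaler_suml.
rewrite exchange_big pair_bigA /=; apply: eq_bigr => -[i e] _ /=.
by rewrite linearZ /= row_mxKr.
Qed.

Lemma prism_faces (S : {set 'I_k * bool}) :
  S \in config_faces (fun z => lift_pt (prism_pt z)) <->
  forall i i' e e', (i, e) \in S -> (i', e') \in S -> (i, e') \in S.
Proof.
have evE (c1 : 'cV[R]_k) (c2 : 'cV[R]_1) i e :
    (prism_pt (i, e) *m col_mx c1 c2) 0 0 = c1 i 0 + (if e then c2 0 0 else 0).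
  rewrite mul_row_col mxE -rowE mxE; congr (_ + _).
  by case: e; rewrite ?mul0mx mxE // big_ord1 mxE mul1r.
split=> [/config_faces_affineP[c [b cb]] i i' e e'|cl].
  rewrite -[c]vsubmxK in cb.
  have [le1 <-] := cb (i, e); have [le2 <-] := cb (i', e').
  have [le3 <-] := cb (i, e'); have [le4 _] := cb (i', e).
  (* The values at (i, e) and (i', e') have the same sum as those at (i, e') and (i', e), so two
     tight inequalities force the others to be tight. *)
  rewrite !evE in le1 le2 le3 le4 * => /eqP h1 /eqP h2; apply/eqP; lra.
apply/config_faces_affineP.
have [[[i0 e0] zS]|no] := pselect (exists z, z \in S); last first.
  exists 0, 1 => z; rewrite mulmx0 mxE ler01; split=> //.
  rewrite eq_sym oner_eq0; apply/esym/negP => zS; apply: no; by exists z.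
pose T i := [exists e, (i, e) \in S].
pose E e := [exists i, (i, e) \in S].
have SE i e : ((i, e) \in S) = T i && E e.
  apply/idP/andP => [iS|[/existsP[e1 h1] /existsP[i1 h2]]]; last exact: cl h1 h2.
  by split; apply/existsP; [exists e|exists i].
have c1E i : (\col_i (if T i then 0 else -1) : 'cV[R]_k) i 0 = if T i then 0 else -1.
  by rewrite mxE.
have Ee0 : E e0 by apply/existsP; exists i0.
(* [S] is the product of [T] and [E]. The first summand is 0 on [T] and -1 elsewhere; [t] and the
   bound below make the second one attain the bound exactly on [E]. *)
pose t : R := if E true then (if E false then 0 else 1) else -1.
exists (col_mx (\col_i (if T i then 0 else -1)) (const_mx t)).
exists (if E false then 0 else 1) => -[i e].
rewrite evE c1E SE mxE /t.
case Et: (E true); case Ef: (E false); case: (T i); case: e => /=; rewrite ?Et ?Ef /=;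
  split; rewrite ?addr0 ?add0r ?subrr ?lexx ?eqxx ?ler01 ?lerN10 //; try lra;
  try (by apply/eqP; lra); try (by apply/negbTE/eqP; lra).
all: by move: Ee0; case: (e0); rewrite ?Et ?Ef.
Qed.

End Prism.

Lemma triplex_model_config (R : realType) (k j : nat) :
  exists p : 'I_j + 'I_k * bool -> 'rV[R]_(j + (k + 1)),
  triplex_model R k j = conv_hull (range p) /\
  forall S, S \in config_faces (fun z => lift_pt (p z)) <-> prism_closed S.
Proof.
have [p [hull facesE]] := fold_pyramid_config (@prism_pt R k) j.
exists p; rewrite /triplex_model prism_hull; split=> // S; rewrite facesE.
split=> [/prism_faces cl|cl]; last apply/prism_faces; move=> i i' e e'.
  by have := cl i i' e e'; rewrite !inE.
by rewrite !inE; apply: cl.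
Qed.

Lemma polytope_range (R : realType) (n : nat) (P : set 'rV[R]_n) :
  is_polytope P -> exists (N : nat) (p : 'I_N -> 'rV[R]_n), P = conv_hull (range p).
Proof.
move=> [s ->]; exists (size s), (fun i => s`_i); congr conv_hull.
apply/seteqP; split=> [x /= xs|_ [i _ <-] /=]; last exact: mem_nth.
have ix : (index x s < size s)%N by rewrite index_mem.
by exists (Ordinal ix); rewrite //= nth_index.
Qed.

(** * The face family of a polytope on its own vertices *)

Section VertexFamily.
Variables (R : realType) (n : nat) (I : finType) (p : I -> 'rV[R]_n).
Local Notation P := (conv_hull (range p)).
Local Notation faces := (config_faces (fun i => lift_pt (p i))).
Local Notation rank := (config_rank (fun i => lift_pt (p i))).

Definition polytope_vertex := vertex_of faces rank.
Definition polytope_faces : {set {set polytope_vertex}} := vertex_family faces rank.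
Definition polytope_rank : {set polytope_vertex} -> nat := @vertex_rank _ faces rank.

Let pointed := lift_pointed p.
Let rfF := config_ranked_faces (fun i => lift_pt (p i)).
Let botF := config_bot pointed.
Let rk0 := config_rank0 (fun i => lift_pt (p i)).

Lemma polytope_vertex_faces : vertex_faces polytope_faces polytope_rank.
Proof. by apply: vertex_family_faces => // E EF rE; apply: config_edge. Qed.

Lemma polytope_fnum m : fnum m P =
  #|level polytope_faces polytope_rank finset.set0 finset.setT m.+1|.
Proof.
rewrite fnumE -card_level_vertices // => E EF rE; exact: config_edge.
Qed.

Lemma card_polytope_vertex : #|{: polytope_vertex}| = fnum 0 P.
Proof. by rewrite fnumE card_vertex_of. Qed.

Lemma polytope_rank_top d : has_dim P d -> polytope_rank finset.setT = d.+1.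
Proof.
have fP : is_face P P.
  exists 0, 0; split=> [x _|]; first by rewrite mulmx0 mxE.
  by apply/seteqP; split=> x /=; [rewrite mulmx0 mxE|case].
move=> /(has_dimP d fP); rewrite /polytope_rank vertex_rank_top //.
suff -> : carrier p P = finset.setT by [].
by apply/setP => i; rewrite in_carrier inE; apply/asboolP/vertex_in.
Qed.

Lemma is_triplexP d k : is_triplex d k P <->
  exists psi : 'I_(d - k) + 'I_k * bool -> polytope_vertex,
    bijective psi /\ forall S, S \in polytope_faces <-> prism_closed (psi @^-1: S).
Proof.
rewrite /is_triplex; have [q [-> qE]] := triplex_model_config R k (d - k).
have vf := polytope_vertex_faces.
have iso := vertices_iso rfF botF.
split=> [/comb_equivP[phi phiE]|[psi [psiB psiE]]].
  have [phi' phi'E] := order_iso_sym iso.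
  have [||||psi [psiB psiE]] := order_iso_vertices _ _ _ _ (order_iso_comp phi'E phiE).
  - exact: vf_bot vf.
  - exact: vf_vertex vf.
  - by apply/qE => i i' e e'; rewrite inE.
  - by move=> y; apply/qE => i i' e e'; rewrite !inE => /eqP <- /eqP[_ ->].
  by exists psi; split=> // S; rewrite psiE; apply: qE.
apply/comb_equivP; have SE S : (S \in polytope_faces) =
    (psi @^-1: S \in config_faces (fun z => lift_pt (q z))).
  by apply/idP/idP => [/psiE/qE|/qE/psiE].
eexists; exact: order_iso_comp iso (order_iso_preimset psiB SE).
Qed.

End VertexFamily.

Theorem theorem25 (R : realType) (n d m k : nat) (P : set 'rV[R]_n)
  (hk : (1 <= k <= d)%N)
  (hm : (m + 2 <= d)%N)
  (hmd : 62 / 100 * d%:R <= m%:R :> rat \/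
         6 / 10 * (d%:R - 1) <= m%:R :> rat /\ (d <= 15)%N)
  (hP : is_polytope P)
  (hdim : has_dim P d)
  (hvert : fnum 0 P = (d + k)%N) :
  (is_triplex d k P -> (fnum m P)%:Z = phi m (d + k) d) /\
  (~ is_triplex d k P -> phi m (d + k) d < (fnum m P)%:Z).
Proof.
have m0 : (0 < m)%N.
  rewrite lt0n; apply/eqP => m0; rewrite m0 in hmd hm.
  (* From m = 0 and d >= 2, both lower bounds on [m] would be positive. *)
  have d2 : (2%:R : rat) <= d%:R by rewrite ler_nat; lia.
  by case: hmd => [|[]]; lra.
have [N [p PE]] := polytope_range hP; subst P.
have vf := polytope_vertex_faces p; have rkT := polytope_rank_top hdim.
have cT : #|{: polytope_vertex p}| = (d + k)%N by rewrite card_polytope_vertex.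
rewrite /phi polytope_fnum (_ : (2 * d + 1 - (d + k) = (d - k).+1)%N); last by lia.
rewrite !addn1; split=> [/is_triplexP[psi [psiB psiE]]|ntri].
  have := card_level_of_triplex m vf psiB psiE.
  by rewrite subnK; [lia|case/andP: hk].
have := @lower_bound _ _ _ vf d k m finset.setT (rf_top (vf_ranked vf)) rkT.
rewrite cardsT => /(_ cT hk); rewrite subSn; last by case/andP: hk.
rewrite leq_eqVlt => /orP[/eqP eqm|]; last by lia.
case: ntri; apply/is_triplexP.
(* A simplex has no facet missing two vertices, so it is treated apart. *)
have [k1|k1] := leqP k 1.
  have ek : k = 1%N by lia.
  by subst k; apply: simplex_triplex vf rkT cT _; lia.
apply: (@extremal_triplex _ _ _ d k m vf rkT cT); [by lia|by []|by []|].
by rewrite subSn; [rewrite eqm|lia].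
Qed.
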